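(* Suppose that $r_n(\hat\theta_{n}-\theta_0)\stackrel{d}{\to}G$ as $n\to\infty$, where $G$ has mean zero and variance $\sigma^2>0$. Let $m_n$ be positive integers, and let $\hat\theta_{n,1},\dots,\hat\theta_{n,m_n}$ be the estimators computed from $m_n$ disjoint subsamples of size $n$ each. Put $\bar\theta_{m_n}=\frac1{m_n}\sum_{j=1}^{m_n}\hat\theta_{n,j}$, $\xi_{n,j}=r_n(\hat\theta_{n,j}-\theta_0)$ and $b_n=\mathbb E(\xi_{n,1})$ (assumed well defined). Suppose that $b_n=O(c_n^{-1})$, where $c_n\to\infty$ as $n\to\infty$, and that the sequence $\{\xi_{n,1}^2\}_{n\ge1}$ is uniformly integrable. Then, as $n\to\infty$: (i) for any $m_n\to\infty$ such that $m_n=o(c_n^2)$, $$\sqrt{m_n}\,r_n(\bar\theta_{m_n}-\theta_0)\stackrel{d}{\to}N(0,\sigma^2);$$ (ii) if $m_n\to\infty$, $m_n=O(c_n^2)$ and furthermore $\sqrt{m_n}\,b_n\to\tau$ (a real number), then $$\sqrt{m_n}\,r_n(\bar\theta_{m_n}-\theta_0)\stackrel{d}{\to}N(\tau,\sigma^2).$$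
   Context: $W_1,W_2,\dots$ are i.i.d. random elements with common distribution $P$, and $\theta_0=\theta_0(P)\in\mathbb R$ is a parameter of interest. For each sample size $n$, $\hat\theta_n$ is a real-valued estimator of $\theta_0$ (a measurable function of a sample of size $n$), and $(r_n)$ is a sequence of positive numbers with $r_n=o(\sqrt n)$; the limit $G$ is non-normal. The total sample size is $N=m_n\times n$; the sample is divided into $m_n$ disjoint subsets of size $n$, and $\hat\theta_{n,j}$ is $\hat\theta_n$ applied to the $j$-th subset, so that $\hat\theta_{n,1},\dots,\hat\theta_{n,m_n}$ are i.i.d. *)

(* Defs.v *)
From HB Require Import structures.
From mathcomp Require Import all_boot all_order all_algebra finmap.
From mathcomp Require Import all_classical all_reals all_analysis.
Set Implicit Arguments.
Unset Strict Implicit.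
Unset Printing Implicit Defensive.
Import Order.TTheory GRing.Theory Num.Theory numFieldNormedType.Exports.
Local Open Scope classical_set_scope.
Local Open Scope ring_scope.

Section probability_notions.
Context {d : measure_display} {T : measurableType d} {R : realType}.
Variable P : probability T R.

Definition mutually_independent (d' : measure_display) (S : measurableType d')
    (W : nat -> T -> S) : Prop :=
  forall (J : {fset nat}) (A : nat -> set S),
    (forall i, measurable (A i)) ->
    P (\bigcap_(i in [set` J]) (W i @^-1` A i)) =
    (\prod_(i <- J) P (W i @^-1` A i))%E.

Definition iid (d' : measure_display) (S : measurableType d')
    (W : nat -> {mfun T >-> S}) (law : probability S R) : Prop :=
  (forall (i : nat) (A : set S), measurable A ->
     distribution P (W i) A = law A) /\
  mutually_independent (fun i => W i : T -> S).

(* The limit law is taken as a set function because the library has two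
   measurable structures for the Borel sets of [R], with different displays:
   [distribution] lands in one of them and [normal_prob] in the other. *)
Definition cvg_in_distribution (X : nat -> T -> R)
    (mu : set R -> \bar R) : Prop :=
  forall x : R,
    {for x, continuous (fun y : R => fine (mu [set` `]-oo, y]]))} ->
    P [set w | X n w <= x] @[n --> \oo] --> mu [set` `]-oo, x]].

Definition uniformly_integrable (I : Type) (D : set I) (X : I -> T -> R) : Prop :=
  ereal_sup [set (\int[P]_(w in [set w | (K < `|X i w|)%R]) `|X i w|%:E)%E | i in D]
    @[K --> +oo%R] --> 0%E.

End probability_notions.

Section divided_sample.
Context {d d' : measure_display} {T : measurableType d} {S : measurableType d'}
  {R : realType}.
Variables (W : nat -> T -> S) (theta_hat : forall n, n.-tuple S -> R)
  (theta0 : R) (r : nat -> R).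

Definition full_estimator (n : nat) (w : T) : R :=
  theta_hat [tuple W i w | i < n].

Variable m : nat -> nat.

(* [idx n j i] is the position, in the sample of size [m n * n], of the [i]-th
   observation of the [j]-th subset. *)
Variable idx : forall n, 'I_(m n) -> 'I_n -> 'I_(m n * n).

(* The subsets are disjoint and of size [n]. *)
Definition disjoint_subsamples : Prop :=
  forall n, injective (fun p : 'I_(m n) * 'I_n => idx p.1 p.2).

Definition sub_estimator (n : nat) (j : 'I_(m n)) (w : T) : R :=
  theta_hat [tuple W (idx j i) w | i < n].

Definition averaged_estimator (n : nat) (w : T) : R :=
  (m n)%:R^-1 * \sum_(j < m n) sub_estimator j w.

Definition xi (n : nat) (j : 'I_(m n)) (w : T) : R :=
  r n * (sub_estimator j w - theta0).

Variable m_gt0 : forall n, (0 < m n)%N.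

Definition xi1 (n : nat) : T -> R := xi (Ordinal (m_gt0 n)).

End divided_sample.

(* Main.v *)
(** The observations in distinct subsamples are disjoint blocks of an i.i.d. sequence, so
    the [xi n j], [j < m n], are i.i.d. and distributed as [r n * (theta_hat n - theta0)].
    Convergence in distribution and uniform integrability of the squares give
    [E (xi n j)^2 --> sigma^2]; uniform integrability also gives Lindeberg's condition.
    The central limit theorem for the row sums [S = sum_j X_j], [X_j = xi n j / sqrt (m n)], is
    obtained by Stein's method, without centring: writing [S_j] for [S] without its [j]-th term,
    [E (S f(S)) = sum_j E (X_j (f(S_j) + X_j f'(S_j))) + o(1)
                = tau E f(S) + sigma^2 E f'(S) + o(1)],
    because [sqrt (m n) * b n --> tau] and [E (xi n j)^2 --> sigma^2].
    If [g] has compact support and mean zero under [N(tau, sigma^2)], the Stein equation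
    [sigma^2 f' - (x - tau) f = sigma^2 g] has a compactly supported C^1 solution, so
    [E g(S) --> 0]. Taking [f = id] gives [E S^2 --> tau^2 + sigma^2], hence tightness, and
    the distribution function of [S] is squeezed between expectations of tent functions.
    Part (i) is the case [tau = 0], since [sqrt (m n) * b n = o(c n) * O(1 / c n)]. *)

Require Import Defs.
From HB Require Import structures.
From mathcomp Require Import all_boot all_order all_algebra finmap.
From mathcomp Require Import all_classical all_reals all_analysis.
From mathcomp Require Import measurable_realfun ring lra.
Set Implicit Arguments.
Unset Strict Implicit.
Unset Printing Implicit Defensive.
Import Order.TTheory GRing.Theory Num.Theory numFieldNormedType.Exports.
Local Open Scope classical_set_scope.
Local Open Scope ring_scope.

(** * Real-valued expectations and independence *)

(** Compactly supported test functions make the Stein equation elementary, but they shape the rest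
    of the argument. A test function of nonzero normal mean cannot be centred by a constant without
    losing its compact support; a multiple of a wide plateau is subtracted instead. All that is
    known of the plateau's expectation under the law of [S] is that it is at most 1, so this yields
    upper bounds only. They become two-sided by treating both [S <= x] and [S > x]. These half-lines
    are not compact, and what a tent leaves uncovered is charged to the second moment of [S]. On the
    side of the limit law, distribution functions converge only at continuity points, so the passage
    to second moments uses step functions with nodes at such points. *)

Section real_expectation.
Context {d : measure_display} {T : measurableType d} {R : realType}.
Variable P : probability T R.
Implicit Types (f g : T -> R) (A B : set T).

Lemma le_integrable_fun f g : measurable_fun setT f ->
  P.-integrable setT (EFin \o g) -> (forall x, `|f x| <= g x) ->
  P.-integrable setT (EFin \o f).
Proof.
move=> mf ig fg; apply: le_integrable ig => //; first exact/measurable_EFinP.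
by move=> x _ /=; rewrite lee_fin (le_trans (fg x)) ?ler_norm.
Qed.

Lemma integrable_funD f g : P.-integrable setT (EFin \o f) ->
  P.-integrable setT (EFin \o g) ->
  P.-integrable setT (EFin \o (fun x => f x + g x)).
Proof. by move=> fi gi; exact: (integrableD measurableT fi gi). Qed.

Lemma integrable_funZ k f : P.-integrable setT (EFin \o f) ->
  P.-integrable setT (EFin \o (fun x => k * f x)).
Proof. by move=> fi; exact: (integrableZl measurableT k fi). Qed.

Lemma integrable_funB f g : P.-integrable setT (EFin \o f) ->
  P.-integrable setT (EFin \o g) ->
  P.-integrable setT (EFin \o (fun x => f x - g x)).
Proof. by move=> fi gi; exact: (integrableB measurableT fi gi). Qed.

Lemma integrable_fun_cst k : P.-integrable setT (EFin \o (fun=> k)).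
Proof. exact: finite_measure_integrable_cst. Qed.

Lemma integrable_fun_sum (I : Type) (s : seq I) (h : I -> T -> R) :
  (forall i, P.-integrable setT (EFin \o h i)) ->
  P.-integrable setT (EFin \o (fun x => \sum_(i <- s) h i x)).
Proof.
move=> hi; rewrite (_ : _ \o _ = fun x => \sum_(i <- s) (h i x)%:E)%E.
  by apply: (integrable_sum measurableT) => i _; exact: hi.
by apply/funext => x /=; rewrite sumEFin.
Qed.

Lemma integrable_fun_bounded (c : R) f : measurable_fun setT f ->
  (forall x, `|f x| <= c) -> P.-integrable setT (EFin \o f).
Proof. by move=> mf; apply: le_integrable_fun => //; exact: integrable_fun_cst. Qed.

Lemma integrable_fun_sqr_norm f : measurable_fun setT f ->
  P.-integrable setT (EFin \o (fun x => f x ^+ 2)) ->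
  P.-integrable setT (EFin \o f).
Proof.
move=> mf if2; apply: (le_integrable_fun mf
  (integrable_funD if2 (integrable_fun_cst 1))) => x.
rewrite -[f x ^+ 2]real_normK ?num_real// -subr_ge0.
have -> : `|f x| ^+ 2 + 1 - `|f x| = (`|f x| - 2^-1) ^+ 2 + 3 / 4 by field.
by rewrite addr_ge0 ?sqr_ge0// divr_ge0.
Qed.

Lemma integrable_fun_mul f g : measurable_fun setT f -> measurable_fun setT g ->
  P.-integrable setT (EFin \o (fun x => f x ^+ 2)) ->
  P.-integrable setT (EFin \o (fun x => g x ^+ 2)) ->
  P.-integrable setT (EFin \o (fun x => f x * g x)).
Proof.
move=> mf mg if2 ig2; apply: (le_integrable_fun _ (integrable_funD if2 ig2)).
  exact: measurable_funM.
move=> x; rewrite normrM -[f x ^+ 2]real_normK ?num_real//.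
rewrite -[g x ^+ 2]real_normK ?num_real// -subr_ge0.
have -> : `|f x| ^+ 2 + `|g x| ^+ 2 - `|f x| * `|g x| =
  (`|f x| - `|g x| / 2) ^+ 2 + `|g x| ^+ 2 * (3 / 4) by field.
by rewrite addr_ge0 ?sqr_ge0// mulr_ge0 ?sqr_ge0// divr_ge0.
Qed.

Lemma integrable_fun_sqrD f g : measurable_fun setT f -> measurable_fun setT g ->
  P.-integrable setT (EFin \o (fun x => f x ^+ 2)) ->
  P.-integrable setT (EFin \o (fun x => g x ^+ 2)) ->
  P.-integrable setT (EFin \o (fun x => (f x + g x) ^+ 2)).
Proof.
move=> mf mg if2 ig2.
have -> : (fun x => (f x + g x) ^+ 2) =
    (fun x => f x ^+ 2 + 2 * (f x * g x) + g x ^+ 2).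
  by apply/funext => x; ring.
apply: integrable_funD => //; apply: integrable_funD => //.
by apply: integrable_funZ; exact: integrable_fun_mul.
Qed.

Lemma integrable_fun_sqr_sum (I : Type) (s : seq I) (h : I -> T -> R) :
  (forall i, measurable_fun setT (h i)) ->
  (forall i, P.-integrable setT (EFin \o (fun x => h i x ^+ 2))) ->
  P.-integrable setT (EFin \o (fun x => (\sum_(i <- s) h i x) ^+ 2)).
Proof.
move=> mh ih; elim: s => [|i s IH].
  by under eq_fun do rewrite big_nil expr2 mul0r; exact: integrable_fun_cst.
under eq_fun do rewrite big_cons.
by apply: integrable_fun_sqrD => //; exact: measurable_sum.
Qed.

Lemma Rintegral_sum (I : Type) (s : seq I) (h : I -> T -> R) :
  (forall i, P.-integrable setT (EFin \o h i)) ->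
  \int[P]_x (\sum_(i <- s) h i x) = \sum_(i <- s) \int[P]_x h i x.
Proof.
move=> hi; elim: s => [|i s IH].
  by under eq_Rintegral do rewrite big_nil; rewrite Rintegral_cst// mul0r big_nil.
under eq_Rintegral do rewrite big_cons.
by rewrite RintegralD// ?IH ?big_cons//; exact: integrable_fun_sum.
Qed.

Lemma Rintegral_setT_cst (k : R) : \int[P]_x k = k.
Proof.
by rewrite Rintegral_cst// [X in fine X](probability_setT P) mulr1.
Qed.

Lemma le_normr_Rintegral_dom f g : measurable_fun setT f ->
  P.-integrable setT (EFin \o g) -> (forall x, `|f x| <= g x) ->
  `|\int[P]_x f x| <= \int[P]_x g x.
Proof.
move=> mf ig fg; have fi := le_integrable_fun mf ig fg.
apply: le_trans (le_normr_Rintegral measurableT fi) _.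
by apply: le_Rintegral => //; exact: integrable_norm.
Qed.

Definition independent_pair (X Y : T -> R) : Prop :=
  forall A B : set (R), measurable A -> measurable B ->
  P ((X @^-1` A) `&` (Y @^-1` B)) = (P (X @^-1` A) * P (Y @^-1` B))%E.

(** Independence makes the joint law agree with the product of the marginals on rectangles, hence
    everywhere. Tonelli applied to absolute values gives integrability of the product, after which
    Fubini factors its integral. *)
Lemma Rintegral_indepM (X Y : T -> R) :
  measurable_fun setT X -> measurable_fun setT Y -> independent_pair X Y ->
  P.-integrable setT (EFin \o X) -> P.-integrable setT (EFin \o Y) ->
  P.-integrable setT (EFin \o (fun x => X x * Y x)) /\
  \int[P]_x (X x * Y x) = \int[P]_x X x * \int[P]_x Y x.
Proof.
move=> mX mY XY iX iY.
pose X' : {mfun T >-> R} := HB.pack X (isMeasurableFun.Build _ _ _ _ X mX).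
pose Y' : {mfun T >-> R} := HB.pack Y (isMeasurableFun.Build _ _ _ _ Y mY).
pose XY' (x : T) : R * R := (X x, Y x).
have mXY : measurable_fun setT XY' by exact/measurable_fun_pair.
pose Z : {mfun T >-> (R * R)%type} :=
  HB.pack XY' (isMeasurableFun.Build _ _ _ _ XY' mXY).
have E (A : set (R * R)) : measurable A ->
    (distribution P X' \x distribution P Y')%E A = distribution P Z A.
  by apply: product_measure_unique => A' B mA mB; exact: XY.
pose h (z : R * R) : \bar R := (z.1 * z.2)%:E.
have mh : measurable_fun setT h.
  by apply/measurable_EFinP; exact: measurable_funM.
have mn : measurable_fun setT (fun y : R => `|y|%:E).
  by apply/measurable_EFinP; exact: normr_measurable.
have ih : (distribution P X' \x distribution P Y')%E.-integrable setT h.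
  apply/integrable12ltyP => //.
  under eq_integral => x _.
    under eq_integral => y _.
      rewrite /h /= normrM EFinM; over.
    rewrite ge0_integralZl//.
    over.
  rewrite ge0_integralZr//.
  - rewrite ge0_integral_distribution//.
    rewrite ge0_integral_distribution//.
    move/integrableP: iX => [_ iX]; move/integrableP: iY => [_ iY].
    have eY0 : (0 <= \int[P]_x `|Y x|%:E)%E by exact: integral_ge0.
    have eX0 : (0 <= \int[P]_x `|X x|%:E)%E by exact: integral_ge0.
    by apply: lte_mul_pinfty => //; rewrite ge0_fin_numE.
  - exact: integral_ge0.
have iXY : P.-integrable setT (EFin \o (fun x => X x * Y x)).
  apply/integrableP; split; first exact/measurable_EFinP/measurable_funM.
  move/integrableP: ih => [_].
  rewrite (eq_measure_integral (distribution P Z)); last by move=> *; exact: E.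
  by rewrite ge0_integral_distribution//; exact: measurableT_comp.
split => //; rewrite /Rintegral -fineM; try exact: integrable_fin_num.
congr fine.
have -> : (\int[P]_x (X x * Y x)%:E = \int[distribution P Z]_z h z)%E.
  by rewrite integral_distribution.
rewrite (eq_measure_integral (distribution P X' \x distribution P Y')%E); last first.
  by move=> *; exact/esym/E.
rewrite -integral12_prod_meas1// /fubini_F.
have iY' : (distribution P Y').-integrable setT (EFin \o (fun y : R => y)).
  by apply: integrable_pushforward => //; exact/measurable_EFinP.
have iX' : (distribution P X').-integrable setT (EFin \o (fun y : R => y)).
  by apply: integrable_pushforward => //; exact/measurable_EFinP.
transitivity (\int[distribution P X']_x (x%:E * \int[distribution P Y']_y y%:E))%E.
  by apply: eq_integral => x _; rewrite -integralZl.
have EY : (\int[distribution P Y']_y y%:E = \int[P]_x (Y x)%:E)%E.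
  by rewrite integral_distribution//; exact/measurable_EFinP.
have EX : (\int[distribution P X']_y y%:E = \int[P]_x (X x)%:E)%E.
  by rewrite integral_distribution//; exact/measurable_EFinP.
have iYfin : (\int[P]_x (Y x)%:E)%E \is a fin_num by exact: integrable_fin_num.
by rewrite EY -(fineK iYfin) integralZr// EX.
Qed.

End real_expectation.

Lemma lipschitz_fun_continuous (R : realType) (L : R) (g : R -> R) : 0 <= L ->
  (forall x y, `|g x - g y| <= L * `|x - y|) -> continuous g.
Proof.
move=> L0 gL x; apply/cvgrPdist_le => /= e e0; near=> y.
apply: (le_trans (gL _ _)); rewrite (@le_trans _ _ ((L + 1) * `|x - y|))//.
  by rewrite ler_wpM2r// lerDl.
rewrite mulrC -ler_pdivlMr ?ltr_wpDl//; near: y.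
by apply: cvgr_dist_le; rewrite ?divr_gt0 ?ltr_wpDl//; exact: cvg_id.
Unshelve. all: by end_near. Qed.

Lemma measurable_normr_gt (R : realType) (k : R) : measurable [set x : R | k < `|x|].
Proof.
have := @normr_measurable R setT measurableT _ (measurable_itv `]k, +oo[).
by rewrite setTI; congr measurable; apply/seteqP; split=> x; rewrite /= in_itv /= andbT.
Qed.

Lemma measurable_indic_normr_gt (R : realType) (k : R) :
  measurable_fun setT (\1_[set x : R | k < `|x|] : R -> R).
Proof. by apply: measurable_indic; exact: measurable_normr_gt. Qed.

Lemma indic_normr_gt (R : realType) (k x : R) :
  \1_[set y : R | k < `|y|] x = (k < `|x|)%R%:R :> R.
Proof. by rewrite indicE; congr (nat_of_bool _)%:R; apply/idP/idP; rewrite inE. Qed.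

(** * Stein's method *)

Section stein_inequality.
Context {d : measure_display} {T : measurableType d} {R : realType}.
Variable P : probability T R.

Lemma independent_pair_comp (X Y : T -> R) (f g : R -> R) :
  measurable_fun setT f -> measurable_fun setT g ->
  independent_pair P X Y -> independent_pair P (f \o X) (g \o Y).
Proof.
move=> mf mg XY A B mA mB.
have mfA := mf measurableT A mA; have mgB := mg measurableT B mB.
by rewrite setTI in mfA; rewrite setTI in mgB; exact: (XY _ _ mfA mgB).
Qed.

(** No order between [a] and [b] is assumed because increments of both signs occur. The bound on
    [c - a] serves to compare [f' c] with [f' a] in the Taylor remainder. *)
Lemma mean_value (f f' : R -> R) (a b : R) :
  (forall x : R, is_derive x (1 : R) f (f' x)) ->
  exists c, `|c - a| <= `|b - a| /\ f b - f a = f' c * (b - a).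
Proof.
move=> df; have cf : continuous f.
  by move=> x; apply/differentiable_continuous/derivable1_diffP; case: (df x).
have cfs (u v : R) : {within `[u, v], continuous f}.
  exact: continuous_subspaceT.
have [ab|/ltW ba] := leP a b.
  have [c] := MVT_segment ab (fun x _ => df x) (cfs _ _).
  rewrite in_itv /= => /andP[ac cb] E; exists c; split=> //.
  by rewrite !ger0_norm ?subr_ge0// lerB.
have [c] := MVT_segment ba (fun x _ => df x) (cfs _ _).
rewrite in_itv /= => /andP[bc ca] E; exists c; split; last first.
  by rewrite -[LHS]opprB E -mulrN opprB.
by rewrite !ler0_norm ?subr_le0// !opprB lerB.
Qed.

Section bound.
Variables (m : nat) (X : 'I_m -> T -> R) (f f' : R -> R).
Hypothesis mX : forall j, measurable_fun setT (X j).
Hypothesis X2 : forall j, P.-integrable setT (EFin \o (fun w => X j w ^+ 2)).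
Let S w := \sum_(j < m) X j w.
Hypothesis indX : forall j, independent_pair P (X j) (fun w => S w - X j w).
Variables (a v q C eps dl : R).
Hypothesis C0 : 0 <= C.
Hypothesis dl0 : 0 < dl.
Hypothesis df : forall x : R, is_derive x (1 : R) f (f' x).
Hypothesis mf' : measurable_fun setT f'.
Hypothesis f'C : forall x, `|f' x| <= C.
Hypothesis f'eps : forall x y, `|x - y| <= dl -> `|f' x - f' y| <= eps.
Let D := [set x : R | dl < `|x|].
Hypothesis EX : forall j, \int[P]_w X j w = a.
Hypothesis EX2 : forall j, \int[P]_w (X j w ^+ 2) = v.
Hypothesis EXD : forall j, \int[P]_w (X j w ^+ 2 * \1_D (X j w)) = q.

Let eps0 : 0 <= eps.
Proof. by have := @f'eps 0 0; rewrite !subrr normr0 => -> //; exact: ltW. Qed.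

Let mf : measurable_fun setT f.
Proof.
apply: continuous_measurable_fun => x.
by apply/differentiable_continuous/derivable1_diffP; case: (df x).
Qed.

Let mS : measurable_fun setT S. Proof. exact: measurable_sum. Qed.

Let mSX j : measurable_fun setT (fun w => S w - X j w).
Proof. exact: measurable_funB. Qed.

Let S2 : P.-integrable setT (EFin \o (fun w => S w ^+ 2)).
Proof. exact: integrable_fun_sqr_sum. Qed.

Let m1D : measurable_fun setT (\1_D : R -> R).
Proof. exact: measurable_indic_normr_gt. Qed.

Let iD x : 0 <= (\1_D x : R). Proof. by rewrite indicE ler0n. Qed.

Let iD1 x : (\1_D x : R) <= 1. Proof. by rewrite indicE lern1 leq_b1. Qed.

Let lip x y : `|f x - f y| <= C * `|x - y|.
Proof. by have [c [_ ->]] := mean_value y x df; rewrite normrM ler_wpM2r. Qed.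

(** A small increment costs [eps], a large one [2 * C]. Carrying the large case by an indicator lets
    one pointwise inequality produce, after integration, both the Lindeberg term [q] and a Chebyshev
    term. *)
Let modulus x y : `|f' x - f' y| <= eps + 2 * C * \1_D (x - y).
Proof.
rewrite indicE; case: (boolP (x - y \in D)) => [_|].
  rewrite mulr1 (le_trans (ler_normB _ _))// mulr_natl mulr2n.
  by rewrite (le_trans (lerD (f'C _) (f'C _)))// lerDr.
rewrite notin_setE /D /= => /negP; rewrite -leNgt => xy.
by rewrite mulr0 addr0 f'eps.
Qed.

Let indic_mono x y : `|x| <= `|y| -> \1_D x <= \1_D y :> R.
Proof.
move=> xy; rewrite !indicE; case: (boolP (x \in D)); rewrite ?ler0n//.
rewrite inE /D /= => dx; rewrite mem_set//=; exact: lt_le_trans xy.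
Qed.

(** By the mean value theorem the remainder is [x * (f' c - f' s)] with [c] within [|x|] of [s], so
    no second derivative enters. Multiplied by the further factor [X j] of the Stein sum, it becomes
    the truncated square that Lindeberg's condition controls. *)
Let taylor s x : `|f (s + x) - f s - x * f' s| <= `|x| * (eps + 2 * C * \1_D x).
Proof.
have [c [cs E]] := mean_value s (s + x) df.
move: cs E; rewrite [s + x - s]addrC addKr => cs ->.
rewrite mulrC -mulrBr normrM ler_wpM2l// (le_trans (modulus _ _))//.
by rewrite lerD2l ler_wpM2l ?mulr_ge0// indic_mono.
Qed.

Let if2 (Z : T -> R) : measurable_fun setT Z ->
  P.-integrable setT (EFin \o (fun w => Z w ^+ 2)) ->
  P.-integrable setT (EFin \o (fun w => f (Z w) ^+ 2)).
Proof.
move=> mZ iZ.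
have mfZ : measurable_fun setT (f \o Z) by exact: measurableT_comp.
apply: (@le_integrable_fun _ _ _ P _ (fun w => 2 * f 0 ^+ 2 + 2 * C ^+ 2 * Z w ^+ 2)).
- exact: measurable_funX.
- apply: integrable_funD; first exact: integrable_fun_cst.
  exact: integrable_funZ.
move=> w; rewrite ger0_norm ?sqr_ge0//.
have := lip (Z w) 0; rewrite subr0 => H.
have H2 : (f (Z w) - f 0) ^+ 2 <= C ^+ 2 * Z w ^+ 2.
  rewrite -[leLHS]real_normK ?num_real// -[Z w ^+ 2]real_normK ?num_real//.
  by rewrite -exprMn lerXn2r// nnegrE mulr_ge0.
(* This is [(a + b)^2 <= 2 a^2 + 2 b^2] with [a = f 0] and [b = f (Z w) - f 0]; the defect is the
   square [(f (Z w) - 2 * f 0)^2]. *)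
rewrite -subr_ge0.
have -> : 2 * f 0 ^+ 2 + 2 * C ^+ 2 * Z w ^+ 2 - f (Z w) ^+ 2 =
  2 * (C ^+ 2 * Z w ^+ 2 - (f (Z w) - f 0) ^+ 2) + (f (Z w) - 2 * f 0) ^+ 2 by ring.
by rewrite addr_ge0 ?sqr_ge0// mulr_ge0// subr_ge0.
Qed.

Let mfo (Z : T -> R) : measurable_fun setT Z -> measurable_fun setT (fun w => f (Z w)).
Proof. by move=> mZ; exact: (measurableT_comp mf). Qed.

Let mf'o (Z : T -> R) : measurable_fun setT Z -> measurable_fun setT (fun w => f' (Z w)).
Proof. by move=> mZ; exact: (measurableT_comp mf'). Qed.

Let ifZ (Z : T -> R) : measurable_fun setT Z ->
  P.-integrable setT (EFin \o (fun w => Z w ^+ 2)) ->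
  P.-integrable setT (EFin \o (fun w => f (Z w))).
Proof.
by move=> mZ iZ; apply: integrable_fun_sqr_norm; [exact: mfo|exact: if2].
Qed.

Let if'Z (Z : T -> R) : measurable_fun setT Z ->
  P.-integrable setT (EFin \o (fun w => f' (Z w))).
Proof. by move=> mZ; apply: (@integrable_fun_bounded _ _ _ _ C); [exact: mf'o|]. Qed.

Let SX2 j : P.-integrable setT (EFin \o (fun w => (S w - X j w) ^+ 2)).
Proof.
apply: (@integrable_fun_sqrD _ _ _ _ S (fun w => - X j w)) => //.
  exact: measurable_funN.
by under eq_fun do rewrite sqrrN; exact: X2.
Qed.

Let iX j : P.-integrable setT (EFin \o X j).
Proof. exact: integrable_fun_sqr_norm. Qed.

Let Xf j : P.-integrable setT (EFin \o (fun w => X j w * f (S w - X j w))) /\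
  \int[P]_w (X j w * f (S w - X j w)) = a * \int[P]_w f (S w - X j w).
Proof.
rewrite -(EX j); apply: (@Rintegral_indepM _ _ _ _ (X j) (fun w => f (S w - X j w))).
- by [].
- exact: mfo.
- exact: (@independent_pair_comp _ _ id f _ _ (indX j)).
- by [].
- exact: ifZ.
Qed.

Let Xf' j : P.-integrable setT (EFin \o (fun w => X j w ^+ 2 * f' (S w - X j w))) /\
  \int[P]_w (X j w ^+ 2 * f' (S w - X j w)) = v * \int[P]_w f' (S w - X j w).
Proof.
rewrite -(EX2 j).
apply: (@Rintegral_indepM _ _ _ _ (fun w => X j w ^+ 2) (fun w => f' (S w - X j w))).
- exact: measurable_funX.
- exact: mf'o.
- apply: (@independent_pair_comp _ _ (fun x => x ^+ 2) f' _ _ (indX j)) => //.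
- by [].
- exact: if'Z.
Qed.

(** Writing [S f(S)] as the sum of the [X j * f (S_j + X j)], with [S_j = S - X j] independent of
    [X j], the two leading Taylor terms factor into the subtracted sums. Undoing that factorisation
    puts everything under one integral, where the remainder is bounded pointwise. *)
Let main_term :
  `| \int[P]_w (S w * f (S w)) - \sum_(j < m) a * \int[P]_w f (S w - X j w)
     - \sum_(j < m) v * \int[P]_w f' (S w - X j w) | <= m%:R * (eps * v + 2 * C * q).
Proof.
have iSf : P.-integrable setT (EFin \o (fun w => S w * f (S w))).
  by apply: integrable_fun_mul => //; [exact: mfo|exact: if2].
have iD2 j : P.-integrable setT (EFin \o (fun w => X j w ^+ 2 * \1_D (X j w))).
  apply: (le_integrable_fun _ (X2 j)).
    apply: measurable_funM; first exact: measurable_funX.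
    exact: (measurableT_comp m1D (mX j)).
  move=> w; rewrite ger0_norm; last by apply: mulr_ge0 => //; exact: sqr_ge0.
  by apply: ler_piMr => //; exact: sqr_ge0.
have -> : \sum_(j < m) a * \int[P]_w f (S w - X j w) =
    \int[P]_w (\sum_(j < m) X j w * f (S w - X j w)).
  rewrite Rintegral_sum; last by move=> j; case: (Xf j).
  by apply: eq_bigr => j _; rewrite (Xf j).2.
have -> : \sum_(j < m) v * \int[P]_w f' (S w - X j w) =
    \int[P]_w (\sum_(j < m) X j w ^+ 2 * f' (S w - X j w)).
  rewrite Rintegral_sum; last by move=> j; case: (Xf' j).
  by apply: eq_bigr => j _; rewrite (Xf' j).2.
have i1 := integrable_fun_sum (index_enum 'I_m) (fun j => (Xf j).1).
have i2 := integrable_fun_sum (index_enum 'I_m) (fun j => (Xf' j).1).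
rewrite -RintegralB// -RintegralB//; last exact: integrable_funB.
have i3 j : P.-integrable setT (EFin \o (fun w =>
    eps * X j w ^+ 2 + 2 * C * (X j w ^+ 2 * \1_D (X j w)))).
  by apply: integrable_funD; exact: integrable_funZ.
have -> : m%:R * (eps * v + 2 * C * q) = \int[P]_w (\sum_(j < m)
    (eps * X j w ^+ 2 + 2 * C * (X j w ^+ 2 * \1_D (X j w)))).
  rewrite Rintegral_sum// (eq_bigr (fun=> eps * v + 2 * C * q)).
    by rewrite sumr_const card_ord mulr_natl.
  move=> j _; rewrite RintegralD ?RintegralZl ?EX2 ?EXD//; exact: integrable_funZ.
apply: le_normr_Rintegral_dom.
- apply: measurable_funB; first (apply: measurable_funB).
  + by apply: measurable_funM => //; exact: mfo.
  + by apply: measurable_sum => j; apply: measurable_funM => //; exact: mfo.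
  + apply: measurable_sum => j; apply: measurable_funM; first exact: measurable_funX.
    exact: mf'o.
- exact: integrable_fun_sum.
move=> w; rewrite {1}/S mulr_suml -sumrB -sumrB.
apply: (le_trans (ler_norm_sum _ _ _)); apply: ler_sum => j _.
have -> : X j w * f (S w) - X j w * f (S w - X j w) - X j w ^+ 2 * f' (S w - X j w)
  = X j w * (f (S w - X j w + X j w) - f (S w - X j w) - X j w * f' (S w - X j w)).
  by rewrite subrK; ring.
rewrite normrM; apply: (le_trans (ler_wpM2l (normr_ge0 _) (taylor _ _))).
rewrite [leLHS]mulrA -(expr2 `|X j w|) real_normK ?num_real//.
by rewrite le_eqVlt; apply/orP; left; apply/eqP; ring.
Qed.

(* In the application [m a --> tau], [m v --> s^2], [m q --> 0] by Lindeberg's condition, and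
   [eps] is a multiple of [dl], which is arbitrary. *)
Lemma stein_inequality :
  `| \int[P]_w (S w * f (S w)) - m%:R * a * \int[P]_w f (S w)
     - m%:R * v * \int[P]_w f' (S w) | <=
  m%:R * (eps * v + 2 * C * q) + m%:R * `|a| * C * (dl + v / dl)
  + m%:R * v * (eps + 2 * C * v / dl ^+ 2).
Proof.
(* If [m] is 0 the hypotheses say nothing about [v], so its sign is available only in the presence
   of an index. *)
have v0 (j : 'I_m) : 0 <= v by rewrite -(EX2 j) Rintegral_ge0// => w _; exact: sqr_ge0.
have H1 : `|\sum_(j < m) a * \int[P]_w f (S w - X j w) - m%:R * a * \int[P]_w f (S w)|
    <= m%:R * `|a| * C * (dl + v / dl).
  have -> : m%:R * a * \int[P]_w f (S w) = \sum_(j < m) a * \int[P]_w f (S w).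
    by rewrite sumr_const card_ord -[RHS]mulr_natl mulrA.
  rewrite -sumrB; apply: (le_trans (ler_norm_sum _ _ _)).
  have -> : m%:R * `|a| * C * (dl + v / dl) = \sum_(j < m) `|a| * (C * (dl + v / dl)).
    by rewrite sumr_const card_ord -[RHS]mulr_natl !mulrA.
  apply: ler_sum => j _; rewrite -mulrBr normrM ler_wpM2l//.
  rewrite -RintegralB//; [|exact: ifZ|exact: ifZ].
  (* Restoring [X j] inside [f] costs [C * E |X j|]. The estimate [|x| <= dl + x^2 / dl] bounds the
     first absolute moment by the second moment without square roots. *)
  have i1 : P.-integrable setT (EFin \o (fun w => C * (dl + dl^-1 * X j w ^+ 2))).
    apply: integrable_funZ; apply: integrable_funD; first exact: integrable_fun_cst.
    exact: integrable_funZ.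
  have -> : C * (dl + v / dl) = \int[P]_w (C * (dl + dl^-1 * X j w ^+ 2)).
    rewrite RintegralZl//; last first.
      by apply: integrable_funD; [exact: integrable_fun_cst|exact: integrable_funZ].
    rewrite RintegralD//; [|exact: integrable_fun_cst|exact: integrable_funZ].
    by rewrite RintegralZl// Rintegral_setT_cst EX2 [v / _]mulrC.
  apply: le_normr_Rintegral_dom => //.
    by apply: measurable_funB; exact: mfo.
  move=> w; apply: (le_trans (lip _ _)); rewrite ler_wpM2l//.
  rewrite [S w - X j w - _]addrC addKr normrN.
  rewrite -[X j w ^+ 2]real_normK ?num_real// -subr_ge0.
  have -> : dl + dl^-1 * `|X j w| ^+ 2 - `|X j w| =
     dl^-1 * ((`|X j w| - dl / 2) ^+ 2 + dl ^+ 2 * (3 / 4)).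
    by field; exact: lt0r_neq0.
  by rewrite mulr_ge0 ?invr_ge0 ?(ltW dl0)// addr_ge0 ?sqr_ge0// mulr_ge0 ?sqr_ge0// divr_ge0.
(* Restoring [X j] inside [f'] costs [eps + 2 * C * P(|X j| > dl)], and Chebyshev's inequality
   bounds the probability by [v / dl^2]. *)
have H2 : `|\sum_(j < m) v * \int[P]_w f' (S w - X j w) - m%:R * v * \int[P]_w f' (S w)|
    <= m%:R * v * (eps + 2 * C * v / dl ^+ 2).
  have -> : m%:R * v * \int[P]_w f' (S w) = \sum_(j < m) v * \int[P]_w f' (S w).
    by rewrite sumr_const card_ord -[RHS]mulr_natl mulrA.
  rewrite -sumrB; apply: (le_trans (ler_norm_sum _ _ _)).
  have -> : m%:R * v * (eps + 2 * C * v / dl ^+ 2) =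
      \sum_(j < m) v * (eps + 2 * C * v / dl ^+ 2).
    by rewrite sumr_const card_ord -[RHS]mulr_natl !mulrA.
  apply: ler_sum => j _; rewrite -mulrBr normrM (ger0_norm (v0 j)) ler_wpM2l ?(v0 j)//.
  rewrite -RintegralB//; [|exact: if'Z|exact: if'Z].
  have i0 : P.-integrable setT (EFin \o (fun w => 2 * C / dl ^+ 2 * X j w ^+ 2)).
    exact: integrable_funZ.
  have -> : eps + 2 * C * v / dl ^+ 2 = \int[P]_w (eps + 2 * C / dl ^+ 2 * X j w ^+ 2).
    rewrite RintegralD//; last exact: integrable_fun_cst.
    by rewrite RintegralZl// Rintegral_setT_cst EX2 mulrAC.
  apply: le_normr_Rintegral_dom => //.
  - by apply: measurable_funB; exact: mf'o.
  - by apply: integrable_funD => //; exact: integrable_fun_cst.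
  move=> w; apply: (le_trans (modulus _ _)); rewrite lerD2l.
  rewrite [S w - X j w - _]addrC addKr -[leRHS]mulrA ler_wpM2l ?mulr_ge0//.
  rewrite indicE; case: (boolP (- X j w \in D)) => [|_].
    rewrite inE /D /= normrN => dX.
    rewrite mulrC ler_pdivlMr ?exprn_gt0// mul1r -[X j w ^+ 2]real_normK ?num_real//.
    by apply: lerXn2r; rewrite ?nnegrE ?(ltW dl0) ?(ltW dX).
  by rewrite mulr_ge0 ?sqr_ge0// invr_ge0 sqr_ge0.
set A := \int[P]_w (S w * _); set B := m%:R * a * _; set B' := m%:R * v * _.
move: main_term H1 H2; rewrite -/A -/B -/B'.
set s1 := \sum_(j < m) _; set s2 := \sum_(j < m) _ => H0 H1 H2.
have -> : A - B - B' = (A - s1 - s2) + (s1 - B) + (s2 - B') by ring.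
apply: (le_trans (ler_normD _ _)); apply: lerD => //.
by apply: (le_trans (ler_normD _ _)); exact: lerD.
Qed.

End bound.
End stein_inequality.

(** * Blocks of an i.i.d. sequence *)

Section equality_in_law.
Context {d d' : measure_display} {T : measurableType d} {S : measurableType d'}
  {R : realType}.
Variable P : probability T R.

(** Both integrals are differences of integrals of positive and negative parts, and each part is an
    integral against the common image measure. The extended-valued form lets it transfer
    integrability between subsamples, not only values. *)
Lemma eq_law_integral (U V : T -> S) (h : S -> \bar R) :
  measurable_fun setT U -> measurable_fun setT V -> measurable_fun setT h ->
  (forall A, measurable A -> P (U @^-1` A) = P (V @^-1` A)) ->
  (\int[P]_w h (U w) = \int[P]_w h (V w))%E.
Proof.
move=> mU mV mh UV.
have ge0 (k : S -> \bar R) : measurable_fun setT k -> (forall x, 0 <= k x)%E ->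
    (\int[P]_w k (U w) = \int[P]_w k (V w))%E.
  move=> mk k0.
  rewrite -(ge0_integral_pushforward (phi := U) mU P (D := setT))//.
  rewrite -[RHS](ge0_integral_pushforward (phi := V) mV P (D := setT))//.
  by apply: eq_measure_integral => A mA _; exact: UV.
change (\int[P]_w (h \o U) w = \int[P]_w (h \o V) w)%E.
rewrite [LHS]integralE [RHS]integralE (funepos_comp h U)
  (funepos_comp h V) (funeneg_comp h U) (funeneg_comp h V).
congr (_ - _)%E; apply: ge0 => //; first exact: measurable_funepos.
exact: measurable_funeneg.
Qed.

(** The set functions sending [A] to [P (A n F)], with [n] for intersection, and to [P F * P A] are
    finite measures that agree on a pi-system containing the whole space, hence on the sigma-algebra
    it generates. *)
Lemma independent_generated (G : set (set T)) (F : set T) :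
  G `<=` measurable -> setI_closed G -> G setT -> measurable F ->
  (forall A, G A -> P (A `&` F) = P A * P F)%E ->
  forall A, <<s G >> A -> (P (A `&` F) = P A * P F)%E.
Proof.
move=> Gm GI GT mF GF A sA.
have PF0 : 0 <= fine (P F) by rewrite fine_ge0.
have PFE : (fine (P F))%:E = P F by rewrite fineK// fin_num_measure.
have <- : mscale (NngNum PF0) P A = (P A * P F)%E by rewrite /mscale /= PFE muleC.
have -> : (P (A `&` F) = mrestr P mF A)%E by [].
apply: (@g_sigma_algebra_measure_unique _ _ _ G Gm (fun=> setT)) => //.
- by rewrite bigcup_const//; exists 0%N.
- by move=> B GB /=; rewrite /mrestr GF// /mscale /= PFE muleC.
- by move=> _ /=; rewrite /mrestr setTI ltey_eq fin_num_measure.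
Qed.

End equality_in_law.

Section iid_blocks.
Context {d d' : measure_display} {T : measurableType d} {S : measurableType d'}
  {R : realType}.
Variables (P : probability T R) (W : nat -> {mfun T >-> S}) (law : probability S R).
Hypothesis W_iid : iid P W law.

(* [<<s cylinders I >>] is the sigma-algebra generated by the [W i] with [i] in [I]. *)
Definition cylinders (I : set nat) : set (set T) :=
  [set E | exists (J : {fset nat}) (A : nat -> set S),
    [/\ (forall i, i \in J -> I i), (forall i, measurable (A i)) &
        E = \bigcap_(i in [set` J]) (W i @^-1` A i)]].

Let mW i (A : set S) : measurable A -> measurable (W i @^-1` A).
Proof. by move=> mA; have := measurable_funPT (W i) measurableT _ mA; rewrite setTI. Qed.

Let PW i (A : set S) : measurable A -> P (W i @^-1` A) = law A.
Proof. by move=> mA; rewrite -(W_iid.1 i A mA). Qed.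

(** Padding with [setT] changes neither a cylinder nor the product of its probabilities, the extra
    factors being 1. Two cylinders can therefore be written over the union of their index sets. *)
Let within (J : {fset nat}) (A : nat -> set S) i := if i \in J then A i else setT.

Let measurable_within J A : (forall i, measurable (A i)) ->
  forall i, measurable (within J A i).
Proof. by move=> mA i; rewrite /within; case: ifP. Qed.

Let withinI (J1 J2 : {fset nat}) (A1 A2 : nat -> set S) :
  (\bigcap_(i in [set` J1]) (W i @^-1` A1 i)) `&`
  (\bigcap_(i in [set` J2]) (W i @^-1` A2 i)) =
  \bigcap_(i in [set` (J1 `|` J2)%fset])
    (W i @^-1` (within J1 A1 i `&` within J2 A2 i)%classic).
Proof.
apply/seteqP; split=> w.
  move=> [H1 H2] i /= _; rewrite /within; split.
    by case: ifP => // iJ; exact: H1.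
  by case: ifP => // iJ; exact: H2.
move=> H; split=> i /= iJ.
  by have := (H i); rewrite /= inE iJ /within iJ => /(_ isT)[].
by have := (H i); rewrite /= inE iJ orbT /within iJ => /(_ isT)[].
Qed.

Lemma cylinders_measurable I : cylinders I `<=` measurable.
Proof.
move=> _ [J [A [_ mA ->]]]; apply: fin_bigcap_measurable => // i _; exact: mW.
Qed.

Lemma cylinders_setI I : setI_closed (cylinders I).
Proof.
move=> _ _ [J1 [A1 [J1I mA1 ->]]] [J2 [A2 [J2I mA2 ->]]].
exists (J1 `|` J2)%fset, (fun i => within J1 A1 i `&` within J2 A2 i)%classic; split.
- by move=> i; rewrite inE => /orP[/J1I|/J2I].
- by move=> i; apply: measurableI; exact: measurable_within.
- exact: withinI.
Qed.

Lemma cylinders_setT I : cylinders I setT.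
Proof.
exists fset0%fset, (fun=> setT); split => //.
by apply/seteqP; split.
Qed.

Let cylinders_indep I1 I2 : (forall i, I1 i -> ~ I2 i) ->
  forall E F, cylinders I1 E -> cylinders I2 F -> (P (E `&` F) = P E * P F)%E.
Proof.
move=> I12 _ _ [J1 [A1 [J1I mA1 ->]]] [J2 [A2 [J2I mA2 ->]]].
rewrite withinI (W_iid.2 (J1 `|` J2)%fset); last first.
  by move=> i; apply: measurableI; exact: measurable_within.
rewrite (W_iid.2 J1)// (W_iid.2 J2)//.
have H1 : (\prod_(i <- J1) P (W i @^-1` A1 i) =
    \prod_(i <- (J1 `|` J2)%fset) P (W i @^-1` within J1 A1 i))%E.
  rewrite -(@big_fset_incl _ _ _ _ J1 (J1 `|` J2)%fset); last 2 first.
  - exact: fsubsetUl.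
  - by move=> i _ /negbTE iJ; rewrite /within iJ preimage_setT; exact: probability_setT.
  by rewrite !big_seq; apply: eq_bigr => i iJ; rewrite /within iJ.
have H2 : (\prod_(i <- J2) P (W i @^-1` A2 i) =
    \prod_(i <- (J1 `|` J2)%fset) P (W i @^-1` within J2 A2 i))%E.
  rewrite -(@big_fset_incl _ _ _ _ J2 (J1 `|` J2)%fset); last 2 first.
  - exact: fsubsetUr.
  - by move=> i _ /negbTE iJ; rewrite /within iJ preimage_setT; exact: probability_setT.
  by rewrite !big_seq; apply: eq_bigr => i iJ; rewrite /within iJ.
rewrite H1 H2 -big_split /=; apply: eq_bigr => i _.
rewrite {2 3}/within preimage_setI.
have P1 : P (W i @^-1` setT) = 1%E by rewrite preimage_setT; exact: probability_setT.
case: (boolP (i \in J1)) => iJ1; last first.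
  by rewrite /within (negbTE iJ1) P1 mul1e preimage_setT setTI.
have iJ2 : (i \in J2) = false by apply/negP => /J2I; exact/I12/J1I.
by rewrite /within iJ1 iJ2 P1 mule1 preimage_setT setIT.
Qed.

(** The pi-system argument is used once per side: with [F] fixed it reduces [E] to a cylinder, and
    with that cylinder fixed it reduces [F] to a cylinder. For two cylinders over disjoint positions
    the product formula splits. *)
Lemma cylinders_sigma_indep I1 I2 : (forall i, I1 i -> ~ I2 i) ->
  forall E F, <<s cylinders I1 >> E -> <<s cylinders I2 >> F ->
  (P (E `&` F) = P E * P F)%E.
Proof.
move=> I12 E F sE sF.
have mF : measurable F.
  move: F sF; apply: smallest_sub; first exact: sigma_algebra_measurable.
  exact: cylinders_measurable.
apply: (independent_generated (@cylinders_measurable I1) (@cylinders_setI I1)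
  (cylinders_setT I1) mF) => // A cA; rewrite setIC muleC.
have mA := cylinders_measurable cA.
apply: (independent_generated (@cylinders_measurable I2) (@cylinders_setI I2)
  (cylinders_setT I2) mA) => // B cB.
by rewrite setIC muleC; exact: cylinders_indep cA cB.
Qed.

Lemma cylinders_independent_pair I1 I2 (X Y : T -> R) :
  (forall i, I1 i -> ~ I2 i) ->
  measurable_fun setT (X : g_sigma_algebraType (cylinders I1) -> R) ->
  measurable_fun setT (Y : g_sigma_algebraType (cylinders I2) -> R) ->
  independent_pair P X Y.
Proof.
move=> I12 mX mY A B mA mB; apply: (cylinders_sigma_indep I12).
  by have := mX measurableT A mA; rewrite setTI.
by have := mY measurableT B mB; rewrite setTI.
Qed.

Lemma measurable_cylinders_coord I i : I i ->
  measurable_fun setT (W i : g_sigma_algebraType (cylinders I) -> S).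
Proof.
move=> Ii _ A mA; rewrite setTI; apply: sub_sigma_algebra.
exists [fset i]%fset, (fun=> A); split => //.
  by move=> j; rewrite inE => /eqP ->.
apply/seteqP; split=> w; first by move=> Aw j /=; rewrite inE => /eqP ->.
by move=> /(_ i); apply => /=; rewrite inE.
Qed.

Lemma measurable_cylinders_tuple I n (u : 'I_n -> nat) : (forall i, I (u i)) ->
  measurable_fun setT
    ((fun w => [tuple W (u i) w | i < n]) :
      g_sigma_algebraType (cylinders I) -> n.-tuple S).
Proof.
move=> Iu; apply/measurable_fun_tnthP => i.
rewrite (_ : _ \o _ = W (u i)); first exact: measurable_cylinders_coord.
by apply/funext => w /=; rewrite tnth_mktuple.
Qed.

Lemma measurable_iid_tuple n (u : 'I_n -> nat) :
  measurable_fun setT (fun w => [tuple W (u i) w | i < n]).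
Proof.
apply/measurable_fun_tnthP => i.
rewrite (_ : _ \o _ = W (u i)); first exact: measurable_funPT.
by apply/funext => w /=; rewrite tnth_mktuple.
Qed.

Let boxes n : set (set (n.-tuple S)) :=
  [set E | exists A : 'I_n -> set S, (forall i, measurable (A i)) /\
    E = [set t | forall i, A i (tnth t i)]].

Let boxes_law n (u : 'I_n -> nat) (A : 'I_n -> set S) :
  injective u -> (forall i, measurable (A i)) ->
  P [set w | forall i, A i (W (u i) w)] = (\prod_(i < n) law (A i))%E.
Proof.
move=> uinj mA.
(* Mutual independence speaks of families indexed by positions, so the sides of the box are carried
   from coordinates to positions. Injectivity of [u] makes this unambiguous. *)
pose B k := if [pick i | u i == k] is Some i then A i else setT.
have BE i : B (u i) = A i.
  rewrite /B; case: pickP => [j /eqP/uinj -> //|/(_ i)].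
  by rewrite eqxx.
have -> : [set w | forall i, A i (W (u i) w)] =
    \bigcap_(k in [set` [fset u i | i in 'I_n]%fset]) (W k @^-1` B k).
  apply/seteqP; split=> w /=.
    by move=> H k /= /imfsetP[i _ ->]; rewrite /= BE.
  by move=> H i; rewrite -BE; apply: (H (u i)) => /=; rewrite in_imfset.
rewrite (W_iid.2 [fset u i | i in 'I_n]%fset); last first.
  by move=> k; rewrite /B; case: pickP.
rewrite big_imfset /=; last by move=> i j _ _; exact: uinj.
rewrite big_enum /=; apply: eq_bigr => i _.
by rewrite BE PW.
Qed.

(** Under either choice of distinct positions a box has probability the product of the [law (B i)].
    Boxes form a pi-system generating the sigma-algebra of tuples. *)
Lemma iid_tuple_law n (u v : 'I_n -> nat) : injective u -> injective v ->
  forall A : set (n.-tuple S), measurable A ->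
  P ((fun w => [tuple W (u i) w | i < n]) @^-1` A) =
  P ((fun w => [tuple W (v i) w | i < n]) @^-1` A).
Proof.
move=> uinj vinj A mA.
pose U : {mfun T >-> n.-tuple S} := HB.pack (fun w => [tuple W (u i) w | i < n])
  (isMeasurableFun.Build _ _ _ _ _ (measurable_iid_tuple u)).
pose V : {mfun T >-> n.-tuple S} := HB.pack (fun w => [tuple W (v i) w | i < n])
  (isMeasurableFun.Build _ _ _ _ _ (measurable_iid_tuple v)).
have bm : @boxes n `<=` measurable.
  move=> _ [B [mB ->]].
  have -> : [set t : n.-tuple S | forall i, B i (tnth t i)] =
      \bigcap_(i in [set: 'I_n]) ((@tnth n S ^~ i) @^-1` B i).
    by apply/seteqP; split=> t H i //=; exact: H.
  apply: fin_bigcap_measurable => // i _.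
  by have := measurable_tnth i measurableT (mB i); rewrite setTI.
rewrite -/(distribution P U A) -/(distribution P V A).
apply: (@g_sigma_algebra_measure_unique _ _ _ (@boxes n) bm (fun=> setT) _ _
  (distribution P U) (distribution P V)).
- by move=> _; exists (fun=> setT); split=> //; apply/seteqP; split.
- by rewrite bigcup_const//; exists 0%N.
- move=> _ _ [B [mB ->]] [C [mC ->]]; exists (fun i => B i `&` C i)%classic; split.
    by move=> i; exact: measurableI.
  apply/seteqP; split=> t /=; first by move=> [HB HC] i; split.
  by move=> H; split=> i; case: (H i).
- move=> _ [B [mB ->]]; rewrite /distribution /pushforward /=.
  have E (u' : 'I_n -> nat) : injective u' ->
      P ((fun w => [tuple W (u' i) w | i < n]) @^-1`
        [set t : n.-tuple S | forall i, B i (tnth t i)]) = (\prod_(i < n) law (B i))%E.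
    move=> u'inj; rewrite -(boxes_law u'inj mB); congr (P _).
    by apply/seteqP; split=> w /= H i; have := H i; rewrite tnth_mktuple.
  by rewrite [LHS]E// [RHS]E.
- by move=> _; rewrite /= ltey_eq fin_num_measure.
(* Generation: measurable sets of tuples come from preimages under single coordinates, and these are
   boxes whose other sides are [setT]. *)
move: A mA; apply: smallest_sub; first exact: smallest_sigma_algebra.
move=> A; rewrite -bigcup_seq => -[i _ [B mB <-]]; apply: sub_sigma_algebra.
exists (fun j => if j == i then B else setT); split.
  by move=> j; case: ifP.
rewrite setTI; apply/seteqP; split=> t /= H; last by have := H i; rewrite eqxx.
by move=> j; case: eqP => // ->.
Qed.

End iid_blocks.

(** * Solving the Stein equation for compactly supported test functions *)

Section stein_solution.
Context {R : realType}.
Notation mu := (@lebesgue_measure R).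

Definition vanishes_outside (A : R) (g : R -> R) := forall x, A < `|x| -> g x = 0.

Lemma vanishing_bounded (A : R) (g : R -> R) : continuous g ->
  vanishes_outside A g -> exists C, 0 <= C /\ forall x, `|g x| <= C.
Proof.
(* [A] may be negative; the maximum with 0 keeps the segment nonempty. *)
move=> cg g0; pose B := Num.max A 0.
have B0 : - B <= B by rewrite ge0_cp// le_max lexx orbT.
have cn : {within `[- B, B], continuous (fun x => `|g x|)}.
  apply: continuous_subspaceT => x; apply: continuous_comp; first exact: cg.
  exact: norm_continuous.
have [c _ H] := EVT_max B0 cn.
exists `|g c|; split=> // x; case: (leP `|x| B) => [|Bx].
  by rewrite ler_norml => xB; apply: H; rewrite in_itv.
by rewrite g0 ?normr0// (le_lt_trans _ Bx)// le_max lexx.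
Qed.

(** Since [p' = - (x - tau) / s^2 * p], multiplying the equation by [p / s^2] turns it into
    [(f p)' = g p], which is integrated from minus infinity. The Lipschitz bound on [f'] is what
    supplies its modulus of continuity in the Stein inequality. *)
Lemma stein_solution (tau s A L : R) (g : R -> R) : 0 < s ->
  (forall x y, `|g x - g y| <= L * `|x - y|) -> vanishes_outside A g ->
  \int[mu]_x (g x * normal_pdf tau s x) = 0 ->
  exists f f' : R -> R, exists C L' : R,
  [/\ 0 <= C, 0 <= L', forall x : R, is_derive x (1 : R) f (f' x),
      (forall x, `|f' x| <= C) /\ (forall x y, `|f' x - f' y| <= L' * `|x - y|) &
      (forall x, s ^+ 2 * f' x - (x - tau) * f x = s ^+ 2 * g x) /\
      (forall x, `|f x| <= C)].
Proof.
move=> s0 gL gA gint.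
have sn0 : s != 0 by exact: lt0r_neq0.
have cg : continuous g.
  apply: (lipschitz_fun_continuous (L := `|L|)) => // x y.
  by rewrite (le_trans (gL _ _))// ler_wpM2r// ler_norm.
have [G [G0 gG]] := vanishing_bounded cg gA.
pose p := normal_pdf tau s.
have cp : continuous p by exact: continuous_normal_pdf.
have cgp : continuous (fun x => g x * p x) by move=> x; apply: cvgM; [exact: cg|exact: cp].
have mgp : measurable_fun setT (fun x => g x * p x).
  exact: continuous_measurable_fun.
have igp : mu.-integrable setT (EFin \o (fun x => g x * p x)).
  have ip := integrable_normal_pdf tau s.
  apply: (le_integrable measurableT _ _ (integrableZl measurableT G ip)).
    exact/measurable_EFinP.
  move=> x _ /=; by rewrite lee_fin normrM [leRHS]normrM (ger0_norm G0) ler_wpM2r.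
have igpS (D : set (measurableTypeR R)) : measurable D ->
    mu.-integrable D (EFin \o (fun x => g x * p x)).
  by move=> mD; exact: integrableS igp.
pose F x := \int[mu]_(t in `]-oo, x]) (g t * p t).
have dF (x : R) : is_derive x (1 : R) F (g x * p x).
  have xx1 : x < x + 1 by rewrite ltrDl.
  have := @continuous_FTC1 R (fun t => g t * p t) -oo%O x (x + 1) xx1
    (igpS _ (measurable_itv _)).
  rewrite ltNyr => /(_ isT (cgp x)).
  by move=> [dF E]; rewrite -E derive1E; exact: derivableP.
have F0 (x : R) : A < `|x| -> F x = 0.
  move=> Ax; case: (ltP x 0) => x0.
    rewrite /F (@eq_Rintegral _ _ _ _ _ (fun=> 0)) ?Rintegral_cst ?mul0r//.
    move=> t; rewrite inE /= in_itv /= => tx.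
    rewrite gA ?mul0r//; apply: (lt_le_trans Ax).
    by rewrite !ler0_norm ?lerN2// ?(le_trans tx)// ltW.
  have : F x + \int[mu]_(t in `]x, +oo[) (g t * p t) = 0.
    rewrite -[RHS]gint.
    have E : [set: measurableTypeR R] = `]-oo, x]%classic `|` `]x, +oo[%classic.
      by rewrite -setCitvl setUv.
    rewrite [in RHS]E Rintegral_setU//; first by rewrite -E.
    by apply/disj_setPLR; rewrite setCitvr.
  rewrite [X in _ + X](@eq_Rintegral _ _ _ _ _ (fun=> 0)) ?Rintegral_cst ?mul0r ?addr0//.
  move=> t; rewrite inE /= in_itv /= andbT => xt.
  rewrite gA ?mul0r//; apply: (lt_trans Ax).
  by rewrite !ger0_norm// ltW// (le_lt_trans x0).
(* [F] vanishes on both sides of the support of [g] because [g p] has integral 0; thus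
   [f = F / p] has compact support and no tail estimate is needed. *)
pose e (x : R) := expR ((x - tau) ^+ 2 / (s ^+ 2 *+ 2)) / normal_peak s.
have pe x : p x * e x = 1.
  rewrite /p normal_pdfE// /e /normal_fun mulNr expRN.
  have pk : normal_peak s != 0 by apply: lt0r_neq0; exact: normal_peak_gt0.
  have := lt0r_neq0 (expR_gt0 ((x - tau) ^+ 2 / (s ^+ 2 *+ 2))).
  by set E := expR _ => E0; field; rewrite pk E0.
have de (x : R) : is_derive x (1 : R) e (e x * ((x - tau) / s ^+ 2)).
  have -> : e = (normal_peak s)^-1 *:
      (expR \o ((s ^+ 2 *+ 2)^-1 *: (id - cst tau : R -> R) ^+ 2)) :> (R -> R).
    by apply/funext => y; rewrite /e !fctE /= mulrC [_ / (_ *+ 2)]mulrC.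
  apply: is_derive_eq.
  have pk : normal_peak s != 0 by apply: lt0r_neq0; exact: normal_peak_gt0.
  rewrite !fctE /= /GRing.scale /= subr0 expr1.
  by set E := expR _; field; rewrite sn0 pk.
pose f x := F x * e x.
pose f' x := g x + (x - tau) / s ^+ 2 * f x.
have df (x : R) : is_derive x (1 : R) f (f' x).
  have H := is_deriveM (dF x) (de x); apply: is_derive_eq.
  rewrite /f' /f /GRing.scale /=; have := pe x; move: (p x) (e x) (F x) => px ex Fx pe1.
  by rewrite -[in RHS](mulr1 (g x)) -pe1; ring.
have f0 : vanishes_outside A f by move=> x Ax; rewrite /f F0 ?mul0r.
have f'0 : vanishes_outside A f' by move=> x Ax; rewrite /f' gA// f0// mulr0 addr0.
have cf : continuous f.
  by move=> x; apply/differentiable_continuous/derivable1_diffP; case: (df x).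
have cid : continuous (fun x : R => (x - tau) / s ^+ 2).
  by move=> x; apply: cvgM; [apply: cvgB; [exact: cvg_id|exact: cvg_cst]|exact: cvg_cst].
have cf' : continuous f'.
  move=> x; apply: cvgD; first exact: cg.
  by apply: cvgM; [exact: cid|exact: cf].
have [C [C0 fC]] := vanishing_bounded cf f0.
have [C' [C'0 f'C']] := vanishing_bounded cf' f'0.
(* [f'] is [g + k]. The summand [g] is only Lipschitz, but [k] is continuously differentiable and
   its derivative, vanishing outside a bounded set, is bounded; so [f'] is Lipschitz with constant
   [|L| + K]. *)
pose k (x : R) := (x - tau) / s ^+ 2 * f x.
pose k' (x : R) := f x / s ^+ 2 + (x - tau) / s ^+ 2 * f' x.
have dk (x : R) : is_derive x (1 : R) k (k' x).
  have -> : k = ((s ^+ 2)^-1 *: (id - cst tau : R -> R)) * f.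
    by apply/funext => y; rewrite /k !fctE /= [_ / _]mulrC.
  apply: is_derive_eq; rewrite /k' !fctE /= /GRing.scale /=; ring.
have ck' : continuous k'.
  move=> x; apply: cvgD; first by apply: cvgM; [exact: cf|exact: cvg_cst].
  by apply: cvgM; [exact: cid|exact: cf'].
have k'0 : vanishes_outside A k'.
  by move=> x Ax; rewrite /k' f0// f'0// mulr0 mul0r addr0.
have [K [K0 kK]] := vanishing_bounded ck' k'0.
exists f, f', (C + C'), (`|L| + K); split => //.
- by rewrite addr_ge0.
- by rewrite addr_ge0.
- split; first by move=> x; rewrite (le_trans (f'C' x))// lerDr.
  move=> x y; rewrite /f' -/(k x) -/(k y).
  rewrite (_ : _ - _ = (g x - g y) + (k x - k y)); last by ring.
  rewrite (le_trans (ler_normD _ _))// mulrDl lerD//.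
    by rewrite (le_trans (gL _ _))// ler_wpM2r// ler_norm.
  by have [c [_ ->]] := mean_value y x dk; rewrite normrM ler_wpM2r.
- split; last by move=> x; rewrite (le_trans (fC x))// lerDl.
  by move=> x; rewrite /f'; field.
Qed.


End stein_solution.

(** * Tent functions and estimates for the normal distribution function *)

Section normal_test_functions.
Context {R : realType}.
Variables tau s : R.
Hypothesis s0 : 0 < s.
Notation mu := (@lebesgue_measure R).
Local Notation p := (normal_pdf tau s).

(** For [r >= 0] and [L > 0], a trapezoid centred at [c]: plateau of half-width [r] at height 1,
    sides of slope [L] and horizontal width [L^-1]. It is both Lipschitz and compactly supported, as
    test functions must be. *)
Definition tent (c r L x : R) : R := Num.max 0 (Num.min 1 (1 + L * (r - `|x - c|))).

Lemma tent_ge0 c r L x : 0 <= tent c r L x.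
Proof. by rewrite /tent le_max lexx. Qed.

Lemma tent_le1 c r L x : tent c r L x <= 1.
Proof. by rewrite /tent ge_max ler01 ge_min lexx. Qed.

Lemma tent1 c r L x : 0 <= L -> `|x - c| <= r -> tent c r L x = 1.
Proof.
move=> L0 xr; rewrite /tent min_l; first by rewrite max_r.
by rewrite lerDl mulr_ge0// subr_ge0.
Qed.

Lemma tent0 c r L x : 0 < L -> r + L^-1 <= `|x - c| -> tent c r L x = 0.
Proof.
move=> L0 xr; rewrite /tent max_l// ge_min; apply/orP; right.
have -> : 1 + L * (r - `|x - c|) = L * (r + L^-1 - `|x - c|).
  by field; exact: lt0r_neq0.
by rewrite pmulr_rle0// subr_le0.
Qed.

Lemma tent_lipschitz c r L x y : 0 <= L ->
  `|tent c r L x - tent c r L y| <= L * `|x - y|.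
Proof.
move=> L0.
have clamp (a a' : R) : `|Num.max 0 (Num.min 1 a) - Num.max 0 (Num.min 1 a')| <= `|a - a'|.
  rewrite /Num.max /Num.min.
  by repeat case: ifPn; rewrite -?leNgt => *;
    case: (ger0P (a - a')) => *; rewrite ?ler_norml; lra.
apply: (le_trans (clamp _ _)).
rewrite (_ : _ - _ = L * (`|y - c| - `|x - c|)); last by ring.
rewrite normrM (ger0_norm L0) ler_wpM2l// distrC.
apply: (le_trans (ler_dist_dist _ _)); rewrite le_eqVlt; apply/orP; left; apply/eqP.
by congr `| _ |; ring.
Qed.

Lemma continuous_tent c r L : 0 <= L -> continuous (tent c r L).
Proof.
move=> L0; apply: (lipschitz_fun_continuous L0) => x y; exact: tent_lipschitz.
Qed.

Let sn0 : s != 0. Proof. exact: lt0r_neq0. Qed.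

Let ip : mu.-integrable setT (EFin \o p).
Proof. exact: (integrable_normal_pdf tau s). Qed.

Let ipS (D : set (measurableTypeR R)) : measurable D -> mu.-integrable D (EFin \o p).
Proof. by move=> mD; exact: (integrableS measurableT mD). Qed.

Lemma integrable_normal_test (g : R -> R) (C : R) :
  measurable_fun setT g -> (forall x, `|g x| <= C) ->
  mu.-integrable setT (EFin \o (fun x => g x * p x)).
Proof.
move=> mg gC; have C0 : 0 <= C by exact: le_trans (gC 0).
apply: (le_integrable measurableT _ _ (integrableZl measurableT C ip)).
  by apply/measurable_EFinP; apply: measurable_funM => //; exact: measurable_normal_pdf.
by move=> x _ /=; rewrite lee_fin normrM [leRHS]normrM (ger0_norm C0) ler_wpM2r.
Qed.

Lemma normal_test_le (g : R -> R) (D : set (measurableTypeR R)) :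
  measurable_fun setT g -> measurable D -> (forall x, 0 <= g x <= 1) ->
  (forall x, ~ D x -> g x = 0) ->
  \int[mu]_x (g x * p x) <= \int[mu]_(x in D) p x.
Proof.
move=> mg mD g01 gD; rewrite [leRHS]Rintegral_mkcond; apply: le_Rintegral => //.
- apply: (integrable_normal_test (C := 1)) => // x.
  by have /andP[g0 g1] := g01 x; rewrite ger0_norm.
- by rewrite -restrict_EFin; apply/(integrable_mkcond _ mD); exact: ipS.
move=> x _; rewrite patchE; case: ifPn => xD; last first.
  by rewrite gD ?mul0r//; move: xD; rewrite notin_setE.
by rewrite ler_piMl ?normal_pdf_ge0//; case/andP: (g01 x).
Qed.

Lemma normal_test_ge (g : R -> R) (D : set (measurableTypeR R)) :
  measurable_fun setT g -> measurable D -> (forall x, 0 <= g x <= 1) ->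
  (forall x, D x -> g x = 1) ->
  \int[mu]_(x in D) p x <= \int[mu]_x (g x * p x).
Proof.
move=> mg mD g01 gD; rewrite [leLHS]Rintegral_mkcond; apply: le_Rintegral => //.
- by rewrite -restrict_EFin; apply/(integrable_mkcond _ mD); exact: ipS.
- apply: (integrable_normal_test (C := 1)) => // x.
  by have /andP[g0 g1] := g01 x; rewrite ger0_norm.
move=> x _; rewrite patchE; case: ifPn => [|_].
  by rewrite inE => /gD ->; rewrite mul1r.
by rewrite mulr_ge0 ?normal_pdf_ge0//; case/andP: (g01 x).
Qed.

Lemma Rintegral_normal_pdf : \int[mu]_x p x = 1.
Proof. by rewrite /Rintegral integral_normal_pdf. Qed.

Lemma normal_pdf_itv_large e : 0 < e ->
  exists K : R, 0 <= K /\ 1 - e <= \int[mu]_(x in `[- K, K]) p x.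
Proof.
move=> e0; pose F (k : nat) : set (measurableTypeR R) := `[- k%:R, k%:R]%classic.
have UF : \bigcup_k F k = setT.
  apply/seteqP; split => // x _; exists (Num.truncn `|x|).+1 => //.
  by rewrite /F /= in_itv /= -ler_norml ltW// truncnS_gt.
have mF k : measurable (F k) by exact: measurable_itv.
have : normal_prob tau s (F k) @[k --> \oo] --> normal_prob tau s (\bigcup_k F k).
  apply: nondecreasing_cvg_mu => //; first by rewrite UF.
  move=> k l kl; apply/subsetPset => x; rewrite /F /= !in_itv /= -!ler_norml.
  by move=> /le_trans; apply; rewrite ler_nat.
rewrite UF (probability_setT (normal_prob tau s)) => /fine_cvg /cvgrPdist_le /(_ e e0)[k _ kH].
exists k%:R; split=> //.
have := kH k (leqnn k); rewrite /= ler_norml => /andP[_].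
by rewrite lerBlDr addrC -lerBlDr.
Qed.

(** The density never exceeds its peak, so the distribution function is Lipschitz. This prices the
    sloping sides of a tent explicitly. *)
Lemma normal_pdf_itvD x h : 0 <= h ->
  \int[mu]_(y in `]-oo, x + h]) p y <=
  \int[mu]_(y in `]-oo, x]) p y + h * normal_peak s.
Proof.
move=> h0; rewrite -lerBlDl Rintegral_itvB//;
  [|by apply: ipS; exact: measurable_itv|by rewrite bnd_simp lerDl].
have mI : lebesgue_measure (`]x, x + h] : set (measurableTypeR R)) = h%:E.
  rewrite lebesgue_measure_itv /= lte_fin ltrDl; case: ltgtP h0 => // [h0 _|<- _//].
  by rewrite -EFinB addrC addKr.
have hE : h * normal_peak s = \int[mu]_(y in `]x, x + h]) (normal_peak s).
  have mD : measurable (`]x, x + h] : set (measurableTypeR R)) by exact: measurable_itv.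
  rewrite (Rintegral_cst _ mD) mulrC; congr (_ * _).
  by rewrite -[LHS]/(fine h%:E) -mI.
rewrite hE; apply: le_Rintegral => //.
- by apply: ipS; exact: measurable_itv.
- apply: measurable_bounded_integrable; 
    [exact: measurable_itv|by rewrite [X in (X < _)%E]mI ltry|exact: measurable_cst|].
  exists (normal_peak s); split; first exact: num_real.
  by move=> M HM y _ /=; rewrite ger0_norm ?normal_peak_ge0// ltW.
- by move=> y _; exact: normal_pdf_ub.
Qed.

Lemma normal_pdf_itvC x :
  \int[mu]_(y in `]x, +oo[) p y = 1 - \int[mu]_(y in `]-oo, x]) p y.
Proof.
rewrite -Rintegral_normal_pdf.
have E : [set: measurableTypeR R] = `]-oo, x]%classic `|` `]x, +oo[%classic.
  by rewrite -setCitvl setUv.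
rewrite [in RHS]E Rintegral_setU//; first by rewrite addrC addKr.
- by rewrite -E.
- by apply/disj_setPLR; rewrite setCitvr.
Qed.

End normal_test_functions.

(** * Central limit theorem for triangular arrays *)

Section triangular_array.
Context {d : measure_display} {T : measurableType d} {R : realType}.
Variables (P : probability T R) (m : nat -> nat) (xi : forall n, 'I_(m n) -> T -> R).
Variables (b v : nat -> R) (q : nat -> R -> R) (tau s : R).
Hypothesis mxi : forall n j, (0 < n)%N -> measurable_fun setT (@xi n j).
Hypothesis xi2 : forall n j, (0 < n)%N ->
  P.-integrable setT (EFin \o (fun w => @xi n j w ^+ 2)).
Hypothesis indxi : forall n j, (0 < n)%N ->
  independent_pair P (@xi n j) (fun w => \sum_(i < m n) @xi n i w - @xi n j w).
Hypothesis Exi : forall n j, (0 < n)%N -> \int[P]_w @xi n j w = b n.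
Hypothesis Exi2 : forall n j, (0 < n)%N -> \int[P]_w (@xi n j w ^+ 2) = v n.
Hypothesis Exiq : forall n j k, (0 < n)%N ->
  \int[P]_w (@xi n j w ^+ 2 * \1_[set x : R | k < `|x|] (@xi n j w)) = q n k.
Hypothesis q_ge0 : forall n k, 0 <= q n k.
Hypothesis q_small : forall e, 0 < e ->
  exists K, forall n k, (0 < n)%N -> K <= k -> q n k <= e.
Hypothesis m_oo : ((m n)%:R : R) @[n --> \oo] --> +oo.
Hypothesis tau_cvg : Num.sqrt (m n)%:R * b n @[n --> \oo] --> tau.
Hypothesis v_cvg : v n @[n --> \oo] --> s ^+ 2.
Hypothesis s0 : 0 < s.

Definition normalized_sum n w := (Num.sqrt (m n)%:R)^-1 * \sum_(j < m n) @xi n j w.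
Local Notation S := normalized_sum.

Lemma sqrt_cvg_pinfty : Num.sqrt (m n)%:R @[n --> \oo] --> (+oo : set_system R).
Proof.
apply/cvgryPge => A; near=> n.
rewrite (le_trans (ler_norm A))// -(sqrtr_sqr A) ler_wsqrtr//.
by near: n; move/cvgryPge : m_oo; apply.
Unshelve. all: by end_near. Qed.

Lemma measurable_normalized_sum n : (0 < n)%N -> measurable_fun setT (S n).
Proof.
move=> n0; apply: measurable_funM => //.
by apply: measurable_sum => j; exact: mxi.
Qed.

Lemma normalized_sum_integrable2 n : (0 < n)%N ->
  P.-integrable setT (EFin \o (fun w => S n w ^+ 2)).
Proof.
move=> n0; rewrite /S; under eq_fun do rewrite exprMn.
apply: integrable_funZ; apply: integrable_fun_sqr_sum => j; first exact: mxi.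
exact: xi2.
Qed.

Lemma stein_cvg (f f' : R -> R) (C L : R) : 0 <= C -> 0 <= L ->
  (forall x : R, is_derive x (1 : R) f (f' x)) -> (forall x, `|f' x| <= C) ->
  (forall x y, `|f' x - f' y| <= L * `|x - y|) ->
  \int[P]_w (S n w * f (S n w)) - Num.sqrt (m n)%:R * b n * \int[P]_w f (S n w)
    - v n * \int[P]_w f' (S n w) @[n --> \oo] --> 0.
Proof.
move=> C0 L0 df f'C f'L; apply/cvgrPdist_le => /= e e0.
(* [dl * K] is the limit of the bound in the Stein inequality with [eps = L * dl]: one summand for
   the Taylor remainder, one for restoring [X j] in [f], one for restoring it in [f']. Dividing by
   [K + 1] below avoids a zero divisor. *)
pose K := s ^+ 2 * L + `|tau| * C + s ^+ 2 * L.
have K0 : 0 <= K by rewrite !addr_ge0// mulr_ge0// ?sqr_ge0.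
pose dl := e / 2 / (K + 1).
have dl0 : 0 < dl by rewrite !divr_gt0// ltr_wpDl.
have mf' : measurable_fun setT f'.
  by apply: continuous_measurable_fun; exact: lipschitz_fun_continuous f'L.
pose bound n := (L * dl * v n + 2 * C * q n (dl * Num.sqrt (m n)%:R))
   + `|Num.sqrt (m n)%:R * b n| * C * (dl + v n * (m n)%:R^-1 / dl)
   + v n * (L * dl + 2 * C * (v n * (m n)%:R^-1) / dl ^+ 2).
have minv : (m n)%:R^-1 @[n --> \oo] --> (0 : R).
  by apply/gtr0_cvgV0 => //; near=> n; near: n; move/cvgryPgt : m_oo; apply.
(* Lindeberg's condition: [|X j| > dl] means that [xi] exceeds [dl * sqrt m] in absolute value. This
   level tends to infinity, and [q_small] is uniform over the rows. *)
have q0 : q n (dl * Num.sqrt (m n)%:R) @[n --> \oo] --> 0.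
  apply/cvgrPdist_le => /= e1 /q_small[k qk]; near=> n.
  rewrite sub0r normrN ger0_norm// qk//; first by near: n; exact: nbhs_infty_gt.
  rewrite mulrC -ler_pdivrMr//; near: n.
  by move/cvgryPge : sqrt_cvg_pinfty; apply.
have bound_cvg : bound n @[n --> \oo] --> dl * K.
  have -> : dl * K = (L * dl * s ^+ 2 + 2 * C * 0)
     + `|tau| * C * (dl + s ^+ 2 * 0 / dl)
     + s ^+ 2 * (L * dl + 2 * C * (s ^+ 2 * 0) / dl ^+ 2).
    by rewrite /K; field; exact: lt0r_neq0.
  have vm : v n * (m n)%:R^-1 @[n --> \oo] --> s ^+ 2 * 0 by exact: cvgM.
  apply: cvgD; first apply: cvgD.
  - by apply: cvgD; apply: cvgM => //; exact: cvg_cst.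
  - apply: cvgM; first by apply: cvgM; [exact: cvg_norm|exact: cvg_cst].
    by apply: cvgD; [exact: cvg_cst|apply: cvgM => //; exact: cvg_cst].
  - apply: cvgM => //; apply: cvgD; first exact: cvg_cst.
    apply: cvgM; last exact: cvg_cst.
    by apply: cvgM => //; exact: cvg_cst.
have dlK : dl * K < e.
  have H : dl * (K + 1) = e / 2 by rewrite /dl divfK//; apply: lt0r_neq0; rewrite ltr_wpDl.
  have -> : dl * K = e / 2 - dl by rewrite -H; ring.
  by lra.
near=> n.
have n0 : (0 < n)%N by near: n; exact: nbhs_infty_gt.
have m0 : 0 < (m n)%:R :> R by near: n; move/cvgryPgt : m_oo; apply.
have Be : bound n <= e.
  near: n; apply: (cvgr_le _ bound_cvg); exact: dlK.
rewrite sub0r normrN; apply: le_trans Be.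
have sq0 : 0 < Num.sqrt (m n)%:R :> R by rewrite sqrtr_gt0.
pose X (j : 'I_(m n)) w := (Num.sqrt (m n)%:R)^-1 * @xi n j w.
have SE w : \sum_(j < m n) X j w = S n w by rewrite /S mulr_sumr.
have mE : (m n)%:R = Num.sqrt (m n)%:R ^+ 2 :> R by rewrite sqr_sqrtr// ltW.
have mX j : measurable_fun setT (X j) by apply: measurable_funM => //; exact: mxi.
have X2 j : P.-integrable setT (EFin \o (fun w => X j w ^+ 2)).
  by rewrite /X; under eq_fun do rewrite exprMn; apply: integrable_funZ; exact: xi2.
have iX j : P.-integrable setT (EFin \o @xi n j).
  by apply: integrable_fun_sqr_norm; [exact: mxi|exact: xi2].
have indX j : independent_pair P (X j) (fun w => \sum_(i < m n) X i w - X j w).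
  have -> : (fun w => \sum_(i < m n) X i w - X j w) =
     (fun x : R => (Num.sqrt (m n)%:R)^-1 * x) \o
       (fun w => \sum_(i < m n) @xi n i w - @xi n j w).
    by apply/funext => w; rewrite SE /= mulrBr.
  apply: (@independent_pair_comp _ _ _ _ _ _ (fun x : R => (Num.sqrt (m n)%:R)^-1 * x)).
  - exact: measurable_funM.
  - exact: measurable_funM.
  - exact: indxi.
have EX j : \int[P]_w X j w = (Num.sqrt (m n)%:R)^-1 * b n.
  by rewrite RintegralZl// Exi.
have EX2 j : \int[P]_w (X j w ^+ 2) = (m n)%:R^-1 * v n.
  rewrite /X; under eq_Rintegral do rewrite exprMn.
  by rewrite RintegralZl ?Exi2// ?exprVn -?mE//; exact: xi2.
have EXD j : \int[P]_w (X j w ^+ 2 * \1_[set x : R | dl < `|x|] (X j w)) =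
    (m n)%:R^-1 * q n (dl * Num.sqrt (m n)%:R).
  rewrite -(Exiq j _ n0) -RintegralZl//.
    apply: eq_Rintegral => w _; rewrite /X exprMn exprVn -mE -mulrA; congr (_ * (_ * _)).
    rewrite !indic_normr_gt normrM (ger0_norm (ltW _)) ?invr_gt0//.
    by rewrite [_^-1 * _]mulrC ltr_pdivlMr.
  apply: (le_integrable_fun _ (xi2 j n0)).
    apply: measurable_funM; first by apply: measurable_funX; exact: mxi.
    exact: (measurableT_comp (measurable_indic_normr_gt _) (mxi j n0)).
  move=> w; rewrite indic_normr_gt ger0_norm; last by apply: mulr_ge0; [exact: sqr_ge0|exact: ler0n].
  by apply: ler_piMr; [exact: sqr_ge0|rewrite lern1 leq_b1].
have f'eps x y : `|x - y| <= dl -> `|f' x - f' y| <= L * dl.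
  by move=> xy; apply: (le_trans (f'L x y)); rewrite ler_wpM2l.
have := stein_inequality mX X2 indX C0 dl0 df mf' f'C f'eps EX EX2 EXD.
rewrite /= (_ : (fun w => (\sum_(j < m n) X j w) * f (\sum_(j < m n) X j w)) =
  (fun w => S n w * f (S n w))); last by apply/funext => w; rewrite SE.
rewrite (_ : (fun w => f (\sum_(j < m n) X j w)) = (fun w => f (S n w))); last first.
  by apply/funext => w; rewrite SE.
rewrite (_ : (fun w => f' (\sum_(j < m n) X j w)) = (fun w => f' (S n w))); last first.
  by apply/funext => w; rewrite SE.
have mn0 := lt0r_neq0 m0; have sqn0 := lt0r_neq0 sq0.
rewrite mulVKf// [_ * (_^-1 * b n)](_ : _ = Num.sqrt (m n)%:R * b n); last first.
  by rewrite {1}mE; field.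
have -> : (m n)%:R * `|(Num.sqrt (m n)%:R)^-1 * b n| = `|Num.sqrt (m n)%:R * b n|.
  rewrite -[X in X * _](ger0_norm (ltW m0)) -normrM; congr `| _ |.
  by rewrite {1}mE; field.
move=> /le_trans; apply; rewrite /bound le_eqVlt; apply/orP; left; apply/eqP.
have dln0 := lt0r_neq0 dl0.
by field; rewrite dln0 mn0.
Unshelve. all: by end_near. Qed.

Lemma Rintegral_normalized_sum n : (0 < n)%N -> 0 < (m n)%:R :> R ->
  \int[P]_w S n w = Num.sqrt (m n)%:R * b n.
Proof.
move=> n0 m0; have ixi j : P.-integrable setT (EFin \o @xi n j).
  by apply: integrable_fun_sqr_norm; [exact: mxi|exact: xi2].
rewrite RintegralZl//; last exact: integrable_fun_sum.
rewrite Rintegral_sum// (eq_bigr (fun=> b n)); last by move=> j _; exact: Exi.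
rewrite sumr_const card_ord -[b n *+ _]mulr_natl.
have -> : (m n)%:R = Num.sqrt (m n)%:R ^+ 2 :> R by rewrite sqr_sqrtr// ltW.
rewrite sqrtr_sqr ger0_norm ?sqrtr_ge0//.
by field; rewrite gt_eqF// sqrtr_gt0.
Qed.

(** The identity has [f' = 1], with Lipschitz constant 0, and [E S] equals [sqrt m * b] exactly.
    This unbounded choice is the reason why [stein_cvg] bounds [f'] but not [f]. *)
Lemma second_moment_cvg :
  \int[P]_w (S n w ^+ 2) @[n --> \oo] --> tau ^+ 2 + s ^+ 2.
Proof.
have H : \int[P]_w (S n w * id (S n w)) - Num.sqrt (m n)%:R * b n * \int[P]_w id (S n w)
    - v n * \int[P]_w 1 @[n --> \oo] --> 0.
  apply: (@stein_cvg id (fun=> 1) 1 0) => //.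
  - by move=> x; rewrite normr1.
  - by move=> x y; rewrite subrr normr0 mul0r.
have -> : tau ^+ 2 + s ^+ 2 = 0 + tau ^+ 2 + s ^+ 2 by rewrite add0r.
apply: cvg_trans (cvgD (cvgD H (cvgM tau_cvg tau_cvg)) v_cvg).
apply: near_eq_cvg; near=> n.
have n0 : (0 < n)%N by near: n; exact: nbhs_infty_gt.
have m0 : 0 < (m n)%:R :> R by near: n; move/cvgryPgt : m_oo; apply.
rewrite !fctE /= Rintegral_setT_cst mulr1 (Rintegral_normalized_sum n0 m0).
have -> : \int[P]_w (S n w * S n w) = \int[P]_w (S n w ^+ 2).
  by apply: eq_Rintegral => w _; rewrite expr2.
ring.
Unshelve. all: by end_near. Qed.

(** The Stein equation has the limiting coefficients [tau] and [s^2], whereas [stein_cvg] has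
    [sqrt m * b] and [v]. Boundedness of [f] and [f'] makes the discrepancy vanish. *)
Lemma test_fun_cvg (A L : R) (g : R -> R) :
  (forall x y, `|g x - g y| <= L * `|x - y|) -> vanishes_outside A g ->
  \int[lebesgue_measure]_x (g x * normal_pdf tau s x) = 0 ->
  \int[P]_w g (S n w) @[n --> \oo] --> 0.
Proof.
move=> gL gA g0; have [f [f' [C [L' [C0 L'0 df [f'C f'L] [eqf fC]]]]]] :=
  stein_solution s0 gL gA g0.
have cf : continuous f.
  by move=> x; apply/differentiable_continuous/derivable1_diffP; case: (df x).
have mf : measurable_fun setT f by exact: continuous_measurable_fun.
have cf' : continuous f'.
  exact: lipschitz_fun_continuous f'L.
have mf' : measurable_fun setT f' by exact: continuous_measurable_fun.
have H := stein_cvg C0 L'0 df f'C f'L.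
set D := (X in X @ _ --> _) in H.
have bnd (h : R -> R) n : measurable_fun setT h -> (forall x, `|h x| <= C) ->
    (0 < n)%N -> P.-integrable setT (EFin \o (fun w => h (S n w))) /\
    `|\int[P]_w h (S n w)| <= C.
  move=> mh hC n0.
  have mhS : measurable_fun setT (fun w => h (S n w)).
    exact: (measurableT_comp mh (measurable_normalized_sum n0)).
  split; first exact: (integrable_fun_bounded P mhS (fun w => hC (S n w))).
  rewrite -[leRHS](Rintegral_setT_cst P); apply: le_normr_Rintegral_dom => //.
  exact: integrable_fun_cst.
have s2 : s ^+ 2 != 0 by rewrite expf_neq0// lt0r_neq0.
apply/norm_cvg0P.
have Z : (s ^+ 2)^-1 * (`|D n| + `|s ^+ 2 - v n| * C +
    `|tau - Num.sqrt (m n)%:R * b n| * C) @[n --> \oo] --> 0.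
  have -> : 0 = (s ^+ 2)^-1 * (`|0 : R| + `|s ^+ 2 - s ^+ 2| * C + `|tau - tau| * C) :> R.
    by rewrite !subrr normr0 !mul0r !addr0 mulr0.
  apply: cvgM; first exact: cvg_cst.
  apply: cvgD; first apply: cvgD; first exact: cvg_norm.
  - by apply: cvgM; [apply: cvg_norm; apply: cvgB => //; exact: cvg_cst|exact: cvg_cst].
  - by apply: cvgM; [apply: cvg_norm; apply: cvgB => //; exact: cvg_cst|exact: cvg_cst].
apply: (squeeze_cvgr _ (cvg_cst 0) Z); near=> n.
have n0 : (0 < n)%N by near: n; exact: nbhs_infty_gt.
rewrite normr_ge0 /=.
have [if_ fb] := bnd f n mf fC n0; have [if'_ f'b] := bnd f' n mf' f'C n0.
have iSf : P.-integrable setT (EFin \o (fun w => S n w * f (S n w))).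
  apply: integrable_fun_mul.
  - exact: measurable_normalized_sum.
  - exact: (measurableT_comp mf (measurable_normalized_sum n0)).
  - exact: normalized_sum_integrable2.
  - apply: (@integrable_fun_bounded _ _ _ _ (C ^+ 2)).
      by apply: measurable_funX; exact: (measurableT_comp mf (measurable_normalized_sum n0)).
    move=> w; rewrite normrX; apply: lerXn2r; rewrite ?nnegrE//.
have -> : \int[P]_w g (S n w) = (s ^+ 2)^-1 * (- D n + (s ^+ 2 - v n) *
   \int[P]_w f' (S n w) + (tau - Num.sqrt (m n)%:R * b n) * \int[P]_w f (S n w)).
  have -> : \int[P]_w g (S n w) = \int[P]_w ((s ^+ 2)^-1 *
      (s ^+ 2 * f' (S n w) - S n w * f (S n w) + tau * f (S n w))).
    apply: eq_Rintegral => w _.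
    rewrite (_ : _ + tau * _ = s ^+ 2 * f' (S n w) - (S n w - tau) * f (S n w)).
      by rewrite eqf mulKf.
    by ring.
  have i1 := integrable_funZ (s ^+ 2) if'_.
  have i2 := integrable_funB i1 iSf.
  have i3 := integrable_funZ tau if_.
  rewrite RintegralZl//; last exact: (integrable_funD i2 i3).
  rewrite RintegralD// RintegralB// RintegralZl// RintegralZl// /D; congr (_ * _).
  ring.
rewrite normrM gtr0_norm ?invr_gt0 ?exprn_gt0// ler_wpM2l ?invr_ge0 ?sqr_ge0//.
rewrite (le_trans (ler_normD _ _))// lerD//; last by rewrite normrM ler_wpM2l.
rewrite (le_trans (ler_normD _ _))// lerD//; first by rewrite normrN.
by rewrite normrM ler_wpM2l.
Unshelve. all: by end_near. Qed.

(** Subtracting the right multiple of a wide plateau gives normal mean zero and keeps the support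
    bounded. One inequality suffices, as it will be applied to complementary events. *)
Lemma test_fun_limsup (A L : R) (g : R -> R) (e : R) : 0 <= L ->
  (forall x y, `|g x - g y| <= L * `|x - y|) -> vanishes_outside A g ->
  (forall x, 0 <= g x <= 1) -> 0 < e ->
  \forall n \near \oo, \int[P]_w g (S n w) <=
    \int[lebesgue_measure]_x (g x * normal_pdf tau s x) + e.
Proof.
move=> L0 gL gA g01 e0.
(* From [I <= 1], [I0 >= 1 - e1] and [e1 <= 1 / 2] one gets [I / I0 <= I + 2 * e1]. With
   [e1 <= e / 4] the excess is at most [e / 2], and [h] adds at most [e / 4]. *)
pose e1 := Num.min (e / 4) (1 / 2).
have e10 : 0 < e1 by rewrite lt_min !divr_gt0.
have [K [K0 KH]] := normal_pdf_itv_large tau s e10.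
pose g0 := tent 0 K 1.
have g0L x y : `|g0 x - g0 y| <= 1 * `|x - y| by exact: tent_lipschitz.
have mg0 : measurable_fun setT g0.
  by apply: continuous_measurable_fun; exact: continuous_tent.
have mg : measurable_fun setT g.
  by apply: continuous_measurable_fun; exact: lipschitz_fun_continuous gL.
have g001 x : 0 <= g0 x <= 1 by rewrite tent_ge0 tent_le1.
have ab (h : R -> R) : (forall x, 0 <= h x <= 1) -> forall x, `|h x| <= 1.
  by move=> h01 x; have /andP[h0 h1] := h01 x; rewrite ger0_norm.
set I := \int[lebesgue_measure]_x (g x * _).
pose I0 := \int[lebesgue_measure]_x (g0 x * normal_pdf tau s x).
have I0H : 1 - e1 <= I0.
  apply: (le_trans KH); apply: normal_test_ge => //.
  move=> x; rewrite /= in_itv /= -ler_norml => xK.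
  by apply: tent1 => //; rewrite subr0.
have I1 : 0 <= I <= 1.
  rewrite Rintegral_ge0/=; last first.
    by move=> x _; rewrite mulr_ge0 ?normal_pdf_ge0//; case/andP: (g01 x).
  rewrite -(Rintegral_normal_pdf tau s); by apply: normal_test_le => // x [].
have e1h : e1 <= 1 / 2 by rewrite ge_min lexx orbT.
have e1e : e1 <= e / 4 by rewrite ge_min lexx.
have I00 : 0 < I0 by lra.
pose c := I / I0.
have c0 : 0 <= c by rewrite divr_ge0 ?(ltW I00)//; case/andP: I1.
(* Comparing [g] with the plateau [g0], whose expectation is at most 1. *)
pose h x := g x - c * g0 x.
have hL x y : `|h x - h y| <= (L + c) * `|x - y|.
  rewrite /h (_ : _ - _ = (g x - g y) - c * (g0 x - g0 y)); last by ring.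
  rewrite (le_trans (ler_normB _ _))// mulrDl lerD// normrM (ger0_norm c0).
  by rewrite ler_wpM2l// -[leRHS]mul1r.
have hA : vanishes_outside (Num.max A (K + 1)) h.
  move=> x; rewrite gt_max => /andP[Ax Kx].
  rewrite /h gA// /g0 tent0// ?mulr0 ?subr0// invr1 ltW//.
have h0 : \int[lebesgue_measure]_x (h x * normal_pdf tau s x) = 0.
  have ig := integrable_normal_test tau s mg (ab g g01).
  have ig0 := integrable_normal_test tau s mg0 (ab g0 g001).
  transitivity (\int[lebesgue_measure]_x (g x * normal_pdf tau s x
      - c * (g0 x * normal_pdf tau s x))).
    by apply: eq_Rintegral => x _; rewrite /h; ring.
  rewrite RintegralB//; last exact: (integrableZl measurableT c ig0).
  by rewrite RintegralZl// -/I -/I0 /c divfK ?subrr// lt0r_neq0.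
have Hh := test_fun_cvg hL hA h0.
near=> n.
have n0 : (0 < n)%N by near: n; exact: nbhs_infty_gt.
have hn : \int[P]_w h (S n w) <= e / 4.
  by near: n; apply: (cvgr_le _ Hh); rewrite divr_gt0.
have iS (k : R -> R) : measurable_fun setT k -> (forall x, 0 <= k x <= 1) ->
    P.-integrable setT (EFin \o (fun w => k (S n w))).
  move=> mk k01; apply: (@integrable_fun_bounded _ _ _ _ 1).
    exact: (measurableT_comp mk (measurable_normalized_sum n0)).
  by move=> w; exact: ab.
have E : \int[P]_w g (S n w) = \int[P]_w h (S n w) + c * \int[P]_w g0 (S n w).
  rewrite /h RintegralB ?RintegralZl ?subrK//; try exact: iS.
  by apply: integrable_funZ; exact: iS.
have g0le : \int[P]_w g0 (S n w) <= 1.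
  rewrite -[leRHS](Rintegral_setT_cst P); apply: le_Rintegral => //; first exact: iS.
    exact: integrable_fun_cst.
  by move=> w _; case/andP: (g001 (S n w)).
have cI : c <= I + 2 * e1.
  rewrite /c ler_pdivrMr//; case/andP: I1 => I_ge0 I_le1.
  nra.
rewrite E; have : c * \int[P]_w g0 (S n w) <= c by rewrite ler_piMr.
lra.
Unshelve. all: by end_near. Qed.

(* The term in [K] is the Markov bound for the part of [D] that [g] does not cover. *)
Lemma event_limsup (D : set R) (A L K : R) (g : R -> R) (e : R) :
  measurable D -> 0 <= L ->
  (forall x y, `|g x - g y| <= L * `|x - y|) -> vanishes_outside A g ->
  (forall x, 0 <= g x <= 1) -> 0 < e ->
  (forall x, D x -> 1 <= g x + x ^+ 2 / K ^+ 2) ->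
  \forall n \near \oo, \int[P]_w \1_D (S n w) <=
    \int[lebesgue_measure]_x (g x * normal_pdf tau s x) + e
    + (tau ^+ 2 + s ^+ 2 + 1) / K ^+ 2.
Proof.
move=> mD L0 gL gA g01 e0 Dg.
have Hg := test_fun_limsup L0 gL gA g01 e0.
have mg : measurable_fun setT g.
  by apply: continuous_measurable_fun; exact: lipschitz_fun_continuous gL.
near=> n.
have n0 : (0 < n)%N by near: n; exact: nbhs_infty_gt.
have gn : \int[P]_w g (S n w) <=
    \int[lebesgue_measure]_x (g x * normal_pdf tau s x) + e by near: n.
have Sn : \int[P]_w (S n w ^+ 2) <= tau ^+ 2 + s ^+ 2 + 1.
  by near: n; apply: (cvgr_le _ second_moment_cvg); rewrite ltrDl.
have mS := measurable_normalized_sum n0.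
have ig : P.-integrable setT (EFin \o (fun w => g (S n w))).
  apply: (@integrable_fun_bounded _ _ _ _ 1); first exact: (measurableT_comp mg mS).
  by move=> w; have /andP[h0 h1] := g01 (S n w); rewrite ger0_norm.
have i2 := integrable_funZ (K ^+ 2)^-1 (normalized_sum_integrable2 n0).
have m1D : measurable_fun setT (\1_D : R -> R) by exact: measurable_indic.
apply: (@le_trans _ _ (\int[P]_w (g (S n w) + (K ^+ 2)^-1 * S n w ^+ 2))).
  apply: le_Rintegral => //.
  - apply: (@integrable_fun_bounded _ _ _ _ 1); first exact: (measurableT_comp m1D mS).
    by move=> w; rewrite indicE ger0_norm ?ler0n// lern1 leq_b1.
  - exact: integrable_funD.
  move=> w _; rewrite indicE; case: (boolP (_ \in _)) => [|_].
    by rewrite inE => /Dg; rewrite mulrC.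
  rewrite addr_ge0//; first by case/andP: (g01 (S n w)).
  by rewrite mulr_ge0 ?invr_ge0 ?sqr_ge0.
rewrite RintegralD// RintegralZl//; last exact: normalized_sum_integrable2.
by rewrite lerD// mulrC ler_wpM2r// invr_ge0 sqr_ge0.
Unshelve. all: by end_near. Qed.

(** The tent with plateau from [lo] to [hi] is 1 on the bounded part of [D] and vanishes off [E].
    The alternative [K^2 <= y^2] accommodates a half-line [D], whose far part is left to the second
    moment. *)
Lemma tent_event_limsup (D E : set R) (lo hi L K e : R) :
  measurable D -> measurable (E : set (measurableTypeR R)) ->
  0 < L -> 0 < e -> lo <= hi ->
  (forall y, D y -> lo <= y <= hi \/ K ^+ 2 <= y ^+ 2) -> 0 < K ->
  (forall y, lo - L^-1 < y < hi + L^-1 -> E y) ->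
  \forall n \near \oo, \int[P]_w \1_D (S n w) <=
    \int[lebesgue_measure]_(x in E) normal_pdf tau s x + e
    + (tau ^+ 2 + s ^+ 2 + 1) / K ^+ 2.
Proof.
move=> mD mE L0 e0 lohi DK K0 LE.
pose c := (lo + hi) / 2; pose r := (hi - lo) / 2.
have r0 : 0 <= r by rewrite divr_ge0// subr_ge0.
have LV : 0 < L^-1 by rewrite invr_gt0.
have g01 x : 0 <= tent c r L x <= 1 by rewrite tent_ge0 tent_le1.
have gA : vanishes_outside (`|c| + r + L^-1) (tent c r L).
  move=> x cx; apply: tent0 => //.
  have := ler_normD (x - c) c; rewrite subrK => H.
  by lra.
have Dg x : D x -> 1 <= tent c r L x + x ^+ 2 / K ^+ 2.
  move=> /DK[/andP[lx xh]|Kx].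
    rewrite tent1 ?(ltW L0)//; last by rewrite ler_norml /c /r; lra.
    by rewrite lerDl divr_ge0 ?sqr_ge0.
  rewrite (@le_trans _ _ (x ^+ 2 / K ^+ 2))//; last by rewrite lerDr tent_ge0.
  by rewrite ler_pdivlMr ?mul1r// exprn_gt0.
have H := event_limsup mD (ltW L0) (fun x y => tent_lipschitz c r x y (ltW L0))
  gA g01 e0 Dg.
apply: filterS H => n /le_trans; apply; rewrite !lerD2r.
apply: normal_test_le => //.
  by apply: continuous_measurable_fun; apply: continuous_tent; exact: ltW.
move=> x nE; apply: tent0 => //; rewrite leNgt; apply/negP => cx; apply: nE; apply: LE.
by move: cx; rewrite ltr_norml /c /r; lra.
Qed.

(** The event bound for [S <= x] gives the upper estimate of the distribution function, and the one
    for [S > x] the lower. The error has three equal shares: convergence of the test expectation,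
    the far part of the half-line, and the width of the tent's sides. *)
Lemma normalized_sum_cvg :
  cvg_in_distribution P S (normal_prob tau s).
Proof.
move=> x _; pose Phi y := \int[lebesgue_measure]_(t in `]-oo, y]) normal_pdf tau s t.
have -> : normal_prob tau s [set` `]-oo, x]] = (Phi x)%:E.
  rewrite /Phi /Rintegral fineK//.
  by apply: (fin_num_measure (normal_prob tau s)); exact: measurable_itv.
have mSx n : (0 < n)%N -> measurable [set w | S n w <= x].
  move=> n0; have := measurable_normalized_sum n0 measurableT (measurable_itv `]-oo, x]).
  by rewrite setTI; congr measurable; apply/seteqP; split=> w; rewrite /= in_itv.
pose u n := \int[P]_w \1_[set y : R | y <= x] (S n w).
have uE n : (0 < n)%N -> fine (P [set w | S n w <= x]) = u n.
  move=> n0; have mA := mSx n n0.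
  have <- : (\int[P]_w (\1_[set w | S n w <= x]%R w : R)%:E = P [set w | S n w <= x]%R)%E.
    by rewrite integral_indic// setIT.
  rewrite -/(Rintegral P setT _) /u.
  apply: eq_Rintegral => w _; by rewrite !indicE.
have mle : measurable [set y : R | y <= x] by exact: (measurable_itv `]-oo, x]).
have mgt : measurable [set y : R | x < y].
  have := measurable_itv `]x, +oo[; congr measurable.
  by apply/seteqP; split=> w; rewrite /= in_itv /= andbT.
apply/fine_cvgP; split.
  near=> n; apply: fin_num_measure; apply: mSx; near: n; exact: nbhs_infty_gt.
apply/cvgrPdist_le => /= e e0.
have pk := normal_peak_gt0 (lt0r_neq0 s0).
pose M := tau ^+ 2 + s ^+ 2 + 1.
have M0 : 0 < M by rewrite ltr_wpDl ?addr_ge0 ?sqr_ge0.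
(* Steep enough that a shift by [L^-1] changes the normal distribution function by at most
   [e / 3]. *)
pose L := normal_peak s / (e / 3).
have L0 : 0 < L by rewrite !divr_gt0.
have LV : L^-1 * normal_peak s = e / 3.
  by rewrite /L; field; rewrite (lt0r_neq0 pk) (lt0r_neq0 e0).
have LV0 : 0 < L^-1 by rewrite invr_gt0.
(* The first summand puts [x] between [- K] and [K]; the second gives [K >= 1], hence [K^2 >= K], so
   that the third makes [M / K^2] at most [e / 3]. *)
pose K := `|x| + 1 + M / (e / 3).
have Me : 0 < M / (e / 3) by rewrite !divr_gt0.
have K1 : 1 <= K by rewrite /K -addrA addrCA lerDl addr_ge0// ltW.
have K0 : 0 < K by exact: lt_le_trans K1.
have xK : - K <= x <= K.
  by rewrite -ler_norml /K -addrA lerDl addr_ge0// ltW.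
have MK : M / K ^+ 2 <= e / 3.
  rewrite ler_pdivrMr ?exprn_gt0// mulrC -ler_pdivrMr ?divr_gt0//.
  rewrite (@le_trans _ _ K)//; first by rewrite /K lerDr addr_ge0.
  by rewrite expr2 ler_peMl// ltW.
have e3 : 0 < e / 3 by rewrite divr_gt0.
case/andP: xK => xK1 xK2.
have H1 : \forall n \near \oo, u n <= Phi (x + L^-1) + e / 3 + M / K ^+ 2.
  apply: (tent_event_limsup (lo := - K) (hi := x)) L0 _ _ _ _ _ => //.
  - move=> y /= yx; case: (leP (- K) y) => yK; [left|right]; first by rewrite ?yK ?yx.
    by nra.
  - by move=> y /andP[_ yx]; rewrite /= in_itv /= ltW.
have H2 : \forall n \near \oo, \int[P]_w \1_[set y : R | x < y] (S n w) <=
    \int[lebesgue_measure]_(t in `]x - L^-1, +oo[) normal_pdf tau s t + e / 3 + M / K ^+ 2.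
  apply: (tent_event_limsup (lo := x) (hi := K)) L0 _ _ _ _ _ => //.
  - move=> y /= yx; case: (leP y K) => yK; [left|right]; first by rewrite ?yK ?(ltW yx).
    by nra.
  - by move=> y /andP[xy _]; rewrite /= in_itv /= andbT.
near=> n.
have n0 : (0 < n)%N by near: n; exact: nbhs_infty_gt.
rewrite uE//.
have h1 : u n <= Phi (x + L^-1) + e / 3 + M / K ^+ 2 by near: n.
have h2 : \int[P]_w \1_[set y : R | x < y] (S n w) <=
    \int[lebesgue_measure]_(t in `]x - L^-1, +oo[) normal_pdf tau s t + e / 3 + M / K ^+ 2.
  by near: n.
have mS := measurable_normalized_sum n0.
have i1 (D : set R) : measurable D -> P.-integrable setT (EFin \o (fun w => \1_D (S n w))).
  move=> mD; have m1D : measurable_fun setT (\1_D : R -> R) by exact: measurable_indic.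
  apply: (@integrable_fun_bounded _ _ _ _ 1); first exact: (measurableT_comp m1D mS).
  by move=> w; rewrite indicE ger0_norm ?ler0n// lern1 leq_b1.
have u1 : \int[P]_w \1_[set y : R | x < y] (S n w) = 1 - u n.
  rewrite -[X in X - _](Rintegral_setT_cst P) -RintegralB//; last first.
  - exact: i1.
  - exact: integrable_fun_cst.
  apply: eq_Rintegral => w _; rewrite !indicE.
  have -> : (S n w \in [set y : R | x < y]) = ~~ (S n w <= x).
    by rewrite -ltNge; apply/idP/idP; rewrite inE.
  have -> : (S n w \in [set y : R | y <= x]) = (S n w <= x).
    by apply/idP/idP; rewrite inE.
  by case: (_ <= _); rewrite ?subrr ?subr0.
rewrite u1 normal_pdf_itvC -/(Phi _) in h2.
have p1 : Phi (x + L^-1) <= Phi x + L^-1 * normal_peak s.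
  by apply: normal_pdf_itvD => //; exact: ltW.
have p2 : Phi x <= Phi (x - L^-1) + L^-1 * normal_peak s.
  rewrite -[x in leLHS](subrK L^-1); apply: normal_pdf_itvD => //; exact: ltW.
rewrite LV in p1 p2; rewrite ler_norml.
by lra.
Unshelve. all: by end_near. Qed.

End triangular_array.

(** A monotone function has countably many jumps, so they form a null set and cannot fill an
    interval of positive length. Where the one-sided limits agree, monotonicity squeezes the value
    between them. *)
Lemma monotone_continuity_point (R : realType) (F : R -> R) (a b : R) :
  nondecreasing_fun F -> a < b ->
  exists t, a < t < b /\ {for t, continuous F}.
Proof.
move=> ndF ab.
have ndF' : {in `[a, b] &, nondecreasing_fun F} by move=> x y _ _; exact: ndF.
have [t [tab nt]] : exists t, t \in `]a, b[%R /\ ~ discontinuity F t.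
  apply: contrapT => H.
  have /countable_lebesgue_measure0 := discontinuity_countable ndF'.
  have -> : [set x | x \in `]a, b[%R /\ discontinuity F x] = `]a, b[%classic.
    apply/seteqP; split=> x /=; first by case.
    by move=> xab; split => //; apply: contrapT => nd; apply: H; exists x.
  rewrite lebesgue_measure_itv /= lte_fin ab -EFinB => /eqP.
  by rewrite eqe subr_eq0 gt_eqF.
have lc : cvg (F x @[x --> t^'-]).
  apply: nondecreasing_at_left_is_cvgr.
    by near=> x => y z _ _; exact: ndF.
  near=> x; exists (F t) => _ /= [y yxt <-]; apply: ndF.
  by move: yxt; rewrite in_itv /= => /andP[_ /ltW].
have rc : cvg (F x @[x --> t^'+]).
  apply: nondecreasing_at_right_is_cvgr.
    by near=> x => y z _ _; exact: ndF.
  near=> x; exists (F t) => _ /= [y yxt <-]; apply: ndF.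
  by move: yxt; rewrite in_itv /= => /andP[/ltW].
exists t; split; first by move: tab; rewrite in_itv.
have lr : lim (F x @[x --> t^'-]) = lim (F x @[x --> t^'+]).
  by apply/eqP; apply: contrapT => /negP nE; apply: nt; split.
have l1 : lim (F x @[x --> t^'-]) <= F t.
  apply: limr_le => //; near=> x; apply: ndF.
  by near: x; exact: nbhs_left_le.
have l2 : F t <= lim (F x @[x --> t^'+]).
  apply: limr_ge => //; near=> x; apply: ndF.
  by near: x; exact: nbhs_right_ge.
have lE : lim (F x @[x --> t^'-]) = F t.
  by apply: le_anti; rewrite l1 /= lr.
apply/left_right_continuousP; split.
  by rewrite -[X in _ --> X]lE.
by rewrite -[X in _ --> X]lE lr.
Unshelve. all: by end_near. Qed.

(** * Convergence of second moments *)

Section second_moment_convergence.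
Context {R : realType}.

(** The approximating sum sees [X] only through its distribution function at finitely many nodes.
    Applied with the same nodes to [X n] and to the limit variable, it reduces second moments to
    pointwise convergence there. *)
Lemma step_second_moment {d} {T : measurableType d} (P : probability T R)
    (X : T -> R) (t : nat -> R) (N : nat) (K e : R) :
  measurable_fun setT X -> P.-integrable setT (EFin \o (fun w => X w ^+ 2)) ->
  t 0%N < - K -> K <= t N -> (forall i, t i <= t i.+1) -> 0 <= e ->
  (forall i x, (i < N)%N -> t i <= x <= t i.+1 -> `|x ^+ 2 - t i.+1 ^+ 2| <= e) ->
  `|\int[P]_w (X w ^+ 2) - \sum_(0 <= i < N) t i.+1 ^+ 2 *
     (fine (P [set w | X w <= t i.+1]) - fine (P [set w | X w <= t i]))| <=
  \int[P]_w (X w ^+ 2 * \1_[set x : R | K < `|x|] (X w)) + e.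
Proof.
move=> mX iX2 t0 tN tS e0 te.
(* The sum is the expectation of the step function equal to [t i.+1 ^+ 2] on [`]t i, t i.+1]];
   telescoping the indicators avoids locating the step that contains [X w]. *)
pose I i w : R := (X w <= t i)%R%:R.
have mI i : measurable [set w | X w <= t i].
  have := mX measurableT _ (measurable_itv `]-oo, t i]).
  by rewrite setTI; congr measurable; apply/seteqP; split=> w; rewrite /= in_itv.
have IE i w : I i w = \1_[set w | X w <= t i] w.
  by rewrite indicE /I; congr (nat_of_bool _)%:R; apply/idP/idP; rewrite inE.
have iI i : P.-integrable setT (EFin \o I i).
  rewrite (_ : EFin \o _ = EFin \o \1_[set w | X w <= t i]); first exact: integrable_indic.
  by apply/funext => w /=; rewrite IE.
have EI i : fine (P [set w | X w <= t i]) = \int[P]_w I i w.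
  have -> : P [set w | X w <= t i] = (\int[P]_w (\1_[set w | (X w <= t i)%R] w : R)%:E)%E.
    by rewrite integral_indic// setIT.
  by rewrite -/(Rintegral P setT _); apply: eq_Rintegral => w _; rewrite IE.
have Imono i w : I i w <= I i.+1 w.
  rewrite /I; case: (leP (X w) (t i)) => [H|]; last by rewrite ler0n.
  by rewrite (le_trans H).
have iterm i : P.-integrable setT (EFin \o (fun w => t i.+1 ^+ 2 * (I i.+1 w - I i w))).
  by apply: integrable_funZ; exact: integrable_funB.
have -> : \sum_(0 <= i < N) t i.+1 ^+ 2 *
     (fine (P [set w | X w <= t i.+1]) - fine (P [set w | X w <= t i])) =
   \int[P]_w (\sum_(0 <= i < N) t i.+1 ^+ 2 * (I i.+1 w - I i w)).
  rewrite Rintegral_sum//; apply: eq_bigr => i _.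
  by rewrite RintegralZl ?RintegralB ?EI//; exact: integrable_funB.
have isum := integrable_fun_sum (index_iota 0 N) iterm.
rewrite -RintegralB//.
have i1 : P.-integrable setT (EFin \o (fun w => X w ^+ 2 * \1_[set x : R | K < `|x|] (X w))).
  apply: (le_integrable_fun _ iX2).
    by apply: measurable_funM; [exact: measurable_funX|exact: (measurableT_comp (measurable_indic_normr_gt K) mX)].
  move=> w; rewrite indicE ger0_norm; last by apply: mulr_ge0; [exact: sqr_ge0|exact: ler0n].
  by apply: ler_piMr; [exact: sqr_ge0|rewrite lern1 leq_b1].
have -> : e = \int[P]_w (cst e w) by rewrite Rintegral_setT_cst.
rewrite -RintegralD//; last exact: integrable_fun_cst.
have i2 := integrable_funB iX2 isum.
apply: le_normr_Rintegral_dom.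
- by have /measurable_int/measurable_EFinP := i2.
- by apply: integrable_funD => //; exact: integrable_fun_cst.
move=> w /=.
(* [I N - I 0] indicates that [X] lies between the extreme nodes. Off that event [|X| >= K],
   strictly on its complement within the first summand, so that summand is a tail; the second
   collects the error made inside each step. *)
have -> : X w ^+ 2 - \sum_(0 <= i < N) t i.+1 ^+ 2 * (I i.+1 w - I i w) =
   X w ^+ 2 * (1 - (I N w - I 0%N w)) +
   \sum_(0 <= i < N) (X w ^+ 2 - t i.+1 ^+ 2) * (I i.+1 w - I i w).
  rewrite -(telescope_sumr (fun i => I i w))// mulrBr mulr1 mulr_sumr -addrA.
  congr (_ + _); rewrite -[RHS]opprK; congr (- _).
  by rewrite opprD opprK -sumrB; apply: eq_bigr => i _; ring.
have J01 : 0 <= I N w - I 0%N w.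
  by rewrite -(telescope_sumr (fun i => I i w))// sumr_ge0// => i _; rewrite subr_ge0.
have J1 : I N w - I 0%N w <= 1.
  by rewrite /I; case: (X w <= t N); case: (X w <= t 0%N) => /=; lra.
apply: (le_trans (ler_normD _ _)); apply: lerD.
  rewrite normrM ger0_norm ?sqr_ge0// ler_wpM2l ?sqr_ge0// ger0_norm ?subr_ge0//.
  rewrite indicE; case: (boolP (_ \in _)) => [_|].
    by rewrite lerBlDr lerDl.
  rewrite notin_setE /= => /negP; rewrite -leNgt ler_norml => /andP[x1 x2].
  have -> : I N w = 1 by rewrite /I (le_trans x2 tN).
  have -> : I 0%N w = 0 by rewrite /I leNgt (lt_le_trans t0 x1).
  by rewrite subr0 subrr.
apply: (@le_trans _ _ (\sum_(0 <= i < N) e * (I i.+1 w - I i w))); last first.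
  by rewrite -mulr_sumr (telescope_sumr (fun i => I i w))// ler_piMr.
apply: (le_trans (ler_norm_sum _ _ _)); rewrite !big_nat; apply: ler_sum => i /= iN.
rewrite normrM [X in _ * X <= _]ger0_norm ?subr_ge0//.
rewrite /I; case: (leP (X w) (t i)) => [H|H].
  by rewrite (le_trans H)// subrr !mulr0.
case: (leP (X w) (t i.+1)) => H'; last by rewrite subrr !mulr0.
by rewrite subr0 !mulr1 te// (ltW H).
Qed.

Lemma integrable_tail {d} {T : measurableType d} (P : probability T R)
    (X : T -> R) (e : R) :
  measurable_fun setT X -> P.-integrable setT (EFin \o (fun w => X w ^+ 2)) ->
  0 < e ->
  exists K0, forall K, K0 <= K ->
    \int[P]_w (X w ^+ 2 * \1_[set x : R | K < `|x|] (X w)) <= e.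
Proof.
move=> mX iX2 e0.
pose f (n : nat) w : \bar R := (X w ^+ 2 * \1_[set x : R | n%:R < `|x|] (X w))%:E.
have mfK (K : R) : measurable_fun setT
    (fun w => X w ^+ 2 * \1_[set x : R | K < `|x|] (X w)).
  apply: measurable_funM; first exact: measurable_funX.
  exact: (measurableT_comp (measurable_indic_normr_gt K) mX).
have fK_ge0 (K : R) w : 0 <= X w ^+ 2 * \1_[set x : R | K < `|x|] (X w).
  by apply: mulr_ge0; [exact: sqr_ge0|rewrite indicE ler0n].
have fK_le (K : R) w : X w ^+ 2 * \1_[set x : R | K < `|x|] (X w) <= X w ^+ 2.
  by apply: ler_piMr; [exact: sqr_ge0|rewrite indicE lern1 leq_b1].
have ifK (K : R) : P.-integrable setT
    (EFin \o (fun w => X w ^+ 2 * \1_[set x : R | K < `|x|] (X w))).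
  by apply: (le_integrable_fun _ iX2) => // w; rewrite ger0_norm.
have H : (\int[P]_w f n w @[n --> \oo] --> \int[P]_w (cst 0 w))%E.
  apply: (dominated_cvg _ _ _ _ iX2) => //.
  - by move=> n; apply/measurable_EFinP; exact: mfK.
  - move=> w _; apply: cvg_near_cst; near=> n.
    rewrite /f /= indicE memNset ?mulr0//=; apply/negP; rewrite -leNgt.
    by near: n; exact: nbhs_infty_ger.
  - by move=> n w _; rewrite /f /= lee_fin ger0_norm.
rewrite integral_cst// mul0e in H.
have /fine_cvgP[_ /cvgrPdist_le /(_ e e0)[k _ kH]] := H.
exists k%:R => K kK; have := kH k (leqnn k).
rewrite /= sub0r normrN; apply: le_trans; apply: le_trans (ler_norm _).
rewrite -/(Rintegral P setT _); apply: le_Rintegral => // w _.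
rewrite ler_wpM2l ?sqr_ge0// !indicE.
case: (boolP (_ \in _)); rewrite ?ler0n// inE /= => Kx.
by rewrite mem_set//= (le_lt_trans kK).
Unshelve. all: by end_near. Qed.

(** Truncating the square at [K^2] is truncating [X] at [K]. Integrability comes along, since off
    the tail event the square is at most [K^2]. *)
Lemma uniformly_integrable_sqr_tail {d} {T : measurableType d} (P : probability T R)
    (X : nat -> T -> R) :
  (forall n, (0 < n)%N -> measurable_fun setT (X n)) ->
  uniformly_integrable P [set n | (0 < n)%N] (fun n w => X n w ^+ 2) ->
  forall e, 0 < e -> exists K0 : R, forall n K, (0 < n)%N -> K0 <= K ->
    P.-integrable setT (EFin \o (fun w => X n w ^+ 2)) /\
    \int[P]_w (X n w ^+ 2 * \1_[set x : R | K < `|x|] (X n w)) <= e.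
Proof.
move=> mX ui e e0.
have : \forall K \near +oo, (ereal_sup [set (\int[P]_(w in [set w | K < `|X n w ^+ 2|]%R)
    `|X n w ^+ 2|%:E)%E | n in [set n | (0 < n)%N]] < e%:E)%E.
  apply: (ui [set x | x < e%:E]%E); apply: open_nbhs_nbhs; split.
    exact: open_ereal_lt_ereal.
  by rewrite /= lte_fin.
move=> [K0 [_ K0H]].
(* [K >= 1] gives [K <= K^2], and the extra 1 makes the level [K^2] strictly larger than [K0]. *)
exists (Num.max 1 (K0 + 1)) => n K n0; rewrite ge_max => /andP[K1 K0K].
have K2 : K <= K ^+ 2 by rewrite expr2 ler_peMr// (le_trans ler01).
pose A := [set w | K ^+ 2 < `|X n w ^+ 2|].
have Ae : (\int[P]_(w in A) `|X n w ^+ 2|%:E <= e%:E)%E.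
  apply: ltW; apply: le_lt_trans (K0H (K ^+ 2) _).
    by apply: ereal_sup_ubound; exists n.
  by rewrite (lt_le_trans _ K2)// (lt_le_trans _ K0K)// ltrDl.
have mXn := mX n n0.
have mX2 : measurable_fun setT (fun w => X n w ^+ 2) by exact: measurable_funX.
have mA : measurable A.
  have mn : measurable_fun setT (fun w => `|X n w ^+ 2|).
    exact: (measurableT_comp (@normr_measurable R setT) mX2).
  have := mn measurableT _ (measurable_itv `]K ^+ 2, +oo[).
  by rewrite setTI; congr measurable; apply/seteqP; split=> w; rewrite /= in_itv /= andbT.
have AE w : (\1_A w : R) = \1_[set x : R | K < `|x|] (X n w).
  rewrite !indicE; congr (nat_of_bool _)%:R.
  have E : (K ^+ 2 < `|X n w ^+ 2|) = (K < `|X n w|).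
    rewrite normrX ltr_pXn2r// nnegrE//; exact: le_trans K1.
  by apply/idP/idP; rewrite !inE /A /= E.
have fE : (fun w => (X n w ^+ 2 * \1_[set x : R | K < `|x|] (X n w))%:E) =
    (fun w => `|X n w ^+ 2|%:E)%E \_ A.
  apply/funext => w; rewrite -AE patchE indicE; case: (w \in A).
    by rewrite mulr1 ger0_norm// sqr_ge0.
  by rewrite mulr0.
have iA : P.-integrable setT (fun w => (X n w ^+ 2 * \1_[set x : R | K < `|x|] (X n w))%:E).
  rewrite fE; apply/(integrable_mkcond _ mA); apply/integrableP; split.
    apply/measurable_EFinP; apply: measurable_funTS.
    exact: (measurableT_comp (@normr_measurable R setT) mX2).
  under eq_integral do rewrite /= normr_id.
  exact: le_lt_trans (ltry e).
split.
  apply: (le_integrable_fun mX2 (integrable_funD iA (integrable_fun_cst P (K ^+ 2)))).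
  move=> w; rewrite ger0_norm ?sqr_ge0// -AE indicE.
  case: (boolP (w \in A)) => [_|]; first by rewrite mulr1 lerDl sqr_ge0.
  rewrite notin_setE /A /= => /negP; rewrite -leNgt mulr0 add0r => H.
  exact: le_trans (ler_norm _) H.
rewrite /Rintegral fE -integral_mkcond -lee_fin fineK//.
rewrite ge0_fin_numE; first exact: le_lt_trans (ltry e).
by apply: integral_ge0 => w _; rewrite lee_fin.
Qed.

(** Uniform integrability cuts off the tails, and on a bounded interval the square is close to a
    step function, whose expectation is a finite combination of values of the distribution function.
    The nodes are continuity points of the limiting one. *)
Lemma second_moment_cvg_in_distribution {d dQ} {T : measurableType d}
    {TQ : measurableType dQ} (P : probability T R) (Q : probability TQ R)
    (X : nat -> T -> R) (G : {mfun TQ >-> R}) :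
  (forall n, (0 < n)%N -> measurable_fun setT (X n)) ->
  uniformly_integrable P [set n | (0 < n)%N] (fun n w => X n w ^+ 2) ->
  Q.-integrable setT (EFin \o (fun w => G w ^+ 2)) ->
  cvg_in_distribution P X (distribution Q G) ->
  \int[P]_w (X n w ^+ 2) @[n --> \oo] --> \int[Q]_w (G w ^+ 2).
Proof.
move=> mX ui iG XG; apply/cvgrPdist_le => /= e e0.
(* Five shares: a tail and a step error for [G], the same for [X n], and the difference of the two
   step sums. *)
have e5 : 0 < e / 5 by rewrite divr_gt0.
have mG : measurable_fun setT G by exact: measurable_funPT.
have [K1 H1] := uniformly_integrable_sqr_tail mX ui e5.
have [K2 H2] := integrable_tail mG iG e5.
pose K := Num.max 0 (Num.max K1 K2).
have K0 : 0 <= K by rewrite le_max lexx.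
have KK1 : K1 <= K by rewrite !le_max lexx orbT.
have KK2 : K2 <= K by rewrite !le_max lexx !orbT.
(* Within a step, [x^2 - y^2] factors into a difference of size at most [2 * h] and a sum of size at
   most [2 * (K + 3)], all nodes used being at most [K + 2] in absolute value. *)
pose h := Num.min 1 (e / 5 / (4 * (K + 3))).
have K3 : 0 < 4 * (K + 3) by rewrite mulr_gt0// ltr_wpDl.
have h0 : 0 < h by rewrite lt_min ltr01/= divr_gt0.
have h1 : h <= 1 by rewrite ge_min lexx.
have hK : h * (4 * (K + 3)) <= e / 5 by rewrite -ler_pdivlMr// ge_min lexx orbT.
pose F y := fine (distribution Q G [set` `]-oo, y]]).
have ndF : nondecreasing_fun F.
  move=> x y xy; apply: fine_le; rewrite ?fin_num_measure//.
  by apply: le_measure; rewrite ?inE//; exact: subitvPr.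
(* One node per window of length [h]. Consecutive windows abut, so the nodes increase with gaps
   below [2 * h], and the first lies left of [- K]. *)
have ex_t (i : nat) : exists t, - K - h + i%:R * h < t < - K + i%:R * h /\
    {for t, continuous F}.
  by apply: monotone_continuity_point => //; lra.
have [t tH] := choice ex_t.
have tl i : - K - h + i%:R * h < t i by have [/andP[]] := tH i.
have tu i : t i < - K + i%:R * h by have [/andP[]] := tH i.
(* Large enough for the last node to pass [K], yet with [N * h] at most [2 * K + 2 * h], so that it
   does not pass it by more than [2 * h]. *)
pose N := (Num.truncn ((2 * K + h) / h)).+1.
have Nl : 2 * K + h <= N%:R * h.
  by rewrite -ler_pdivrMr// ltW// truncnS_gt.
have Nu : N%:R * h <= 2 * K + 2 * h.
  rewrite -ler_pdivlMr// /N -natr1.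
  have -> : (2 * K + 2 * h) / h = (2 * K + h) / h + 1 by field; exact: lt0r_neq0.
  rewrite lerD2r truncn_le// divr_ge0 ?(ltW h0)//; lra.
have t0 : t 0%N < - K by have := tu 0%N; rewrite mul0r addr0.
have tN : K <= t N by have := tl N; lra.
have tS i : t i <= t i.+1.
  by have := tu i; have := tl i.+1; rewrite -natr1; lra.
have te i x : (i < N)%N -> t i <= x <= t i.+1 -> `|x ^+ 2 - t i.+1 ^+ 2| <= e / 5.
  move=> iN /andP[tx xt]; apply: le_trans hK.
  have -> : x ^+ 2 - t i.+1 ^+ 2 = (x - t i.+1) * (x + t i.+1) by ring.
  have iN' : i.+1%:R * h <= N%:R * h by rewrite ler_pM2r// ler_nat.
  have i0 : 0 <= i%:R * h by rewrite mulr_ge0// ltW.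
  have := tl i; have := tu i.+1; move: iN'; rewrite -natr1 => iN' a1 a2.
  rewrite normrM (_ : h * _ = (2 * h) * (2 * (K + 3))); last by ring.
  by apply: ler_pM => //; rewrite ler_norml; apply/andP; split; lra.
pose w_ (Fn : R -> R) := \sum_(0 <= i < N) t i.+1 ^+ 2 * (Fn (t i.+1) - Fn (t i)).
pose Fn n y := fine (P [set w | X n w <= y]).
have FnF i : Fn n (t i) @[n --> \oo] --> F (t i).
  have [_ ct] := tH i; have := XG (t i) ct.
  by rewrite -[X in _ --> X]fineK ?fin_num_measure// => /fine_cvg.
have wF : w_ (Fn n) @[n --> \oo] --> w_ F.
  rewrite /w_; elim: (index_iota 0 N) => [|i r IH].
    by rewrite big_nil; under eq_fun do rewrite big_nil; exact: cvg_cst.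
  rewrite big_cons; under eq_fun do rewrite big_cons.
  by apply: cvgD => //; apply: cvgM; [exact: cvg_cst|exact: cvgB].
near=> n.
have n0 : (0 < n)%N by near: n; exact: nbhs_infty_gt.
have wn : `|w_ F - w_ (Fn n)| <= e / 5.
  by near: n; move/cvgrPdist_le : wF; apply.
have [iXn tailn] := H1 n K n0 KK1.
have Xn := step_second_moment (mX n n0) iXn t0 tN tS (ltW e5) te.
have Gn := step_second_moment mG iG t0 tN tS (ltW e5) te.
have tailG := H2 K KK2.
rewrite -/(w_ (Fn n)) in Xn; rewrite -/(w_ F) in Gn.
set a := \int[Q]_w _ in Gn *; set b := \int[P]_w _ in Xn *.
have -> : a - b = (a - w_ F) + (w_ F - w_ (Fn n)) - (b - w_ (Fn n)) by ring.
apply: (le_trans (ler_normB _ _)).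
apply: (@le_trans _ _ (e / 5 + e / 5 + e / 5 + (e / 5 + e / 5))).
  apply: lerD; last by apply: (le_trans Xn); exact: lerD.
  apply: (le_trans (ler_normD _ _)); apply: lerD => //.
  by apply: (le_trans Gn); apply: lerD.
by lra.
Unshelve. all: by end_near. Qed.

End second_moment_convergence.

Lemma sqrt_mul_cvg0 (R : realType) (m : nat -> nat) (b c : nat -> R) :
  c n @[n --> \oo] --> +oo ->
  b =O_\oo (fun n : nat => (c n)^-1) ->
  (fun n : nat => (m n)%:R : R) =o_\oo (fun n : nat => c n ^+ 2) ->
  Num.sqrt (m n)%:R * b n @[n --> \oo] --> 0.
Proof.
move=> c_oo /eqO_exP[k k0 bk] /eqoP mo; apply/cvgrPdist_le => /= e e0.
(* With this constant [sqrt m] is at most [e / k * c], and the bound [k / c] on [b] leaves exactly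
   [e]. *)
have ek : 0 < (e / k) ^+ 2 by rewrite exprn_gt0// divr_gt0.
have mk := mo _ ek.
near=> n.
have c0 : 0 < c n by near: n; move/cvgryPgt : c_oo; apply.
have bn : `|b n| <= k * `|(c n)^-1| by near: n.
have mn : `|(m n)%:R : R| <= (e / k) ^+ 2 * `|c n ^+ 2| by near: n.
rewrite sub0r normrN normrM ger0_norm ?sqrtr_ge0//.
rewrite normr_nat (ger0_norm (sqr_ge0 _)) -exprMn in mn.
have sm : Num.sqrt (m n)%:R <= e / k * c n.
  have /ger0_norm <- : 0 <= e / k * c n by rewrite mulr_ge0// ?divr_ge0// ltW.
  by rewrite -sqrtr_sqr ler_wsqrtr.
apply: (@le_trans _ _ ((e / k * c n) * (k * `|(c n)^-1|))).
  by apply: ler_pM => //; exact: sqrtr_ge0.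
rewrite gtr0_norm ?invr_gt0// le_eqVlt; apply/orP; left; apply/eqP.
by field; rewrite !lt0r_neq0.
Unshelve. all: by end_near. Qed.

(** At mean zero the variance is the extended integral of the square, so its being a real number
    already yields integrability. *)
Lemma mean0_variance (R : realType) (d : measure_display) (T : measurableType d)
    (Q : probability T R) (G : {RV Q >-> R}) (v : R) :
  ('E_Q[G] = 0)%E -> ('V_Q[G] = v%:E)%E ->
  Q.-integrable setT (EFin \o (fun w => G w ^+ 2)) /\ \int[Q]_w (G w ^+ 2) = v.
Proof.
move=> G0; rewrite /variance covariance.unlock G0 /= expectation.unlock => Gv.
have G2 : (\int[Q]_w (G w ^+ 2)%:E = v%:E)%E.
  by rewrite -Gv; apply: eq_integral => w _; rewrite !fctE /= subr0 expr2.
split; last by rewrite /Rintegral G2.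
apply/integrableP; split.
  by apply/measurable_EFinP; apply: measurable_funX; exact: measurable_funPT.
under eq_integral => w _ do rewrite /= ger0_norm ?sqr_ge0//.
by rewrite G2 ltry.
Qed.

(** * Subsample estimators *)

Section divided_sample_theory.
Context {d dS : measure_display} {T : measurableType d} {S : measurableType dS}
  {R : realType}.
Variables (Pr : probability T R) (W : nat -> {mfun T >-> S}) (P : probability S R).
Hypothesis W_iid : iid Pr W P.
Variables (theta_hat : forall n : nat, {mfun n.-tuple S >-> R}) (theta0 : R) (r : nat -> R).
Variables (m : nat -> nat) (m_gt0 : forall n, (0 < m n)%N).
Variable idx : forall n : nat, 'I_(m n) -> 'I_n -> 'I_(m n * n).
Hypothesis idx_disjoint : disjoint_subsamples idx.
Let X n (j : 'I_(m n)) : T -> R := xi W theta_hat theta0 r idx j.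
Let X1 : nat -> T -> R := xi1 W theta_hat theta0 r idx m_gt0.

Let scaled n (t : n.-tuple S) : R := r n * (theta_hat n t - theta0).

Let measurable_scaled n : measurable_fun setT (@scaled n).
Proof.
by apply: measurable_funM => //; exact: measurable_funB.
Qed.

Let idx_inj n (j : 'I_(m n)) : injective (fun i => nat_of_ord (idx j i)).
Proof.
move=> i i' /ord_inj E; have := @idx_disjoint n (j, i) (j, i').
by move=> /(_ E)[].
Qed.

Lemma measurable_xi n (j : 'I_(m n)) : measurable_fun setT (X j).
Proof.
exact: (measurableT_comp (@measurable_scaled n)
  (measurable_iid_tuple W (fun i => nat_of_ord (idx j i)))).
Qed.

Lemma xi_law n (j : 'I_(m n)) (k : R -> R) : measurable_fun setT k ->
  (\int[Pr]_w (k (X j w))%:E = \int[Pr]_w (k (X1 n w))%:E)%E.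
Proof.
move=> mk; pose j0 := Ordinal (m_gt0 n).
apply: (@eq_law_integral _ _ _ _ _ Pr
  (fun w => [tuple W (idx j i) w | i < n]) (fun w => [tuple W (idx j0 i) w | i < n])
  (fun t => (k (scaled t))%:E)).
- exact: measurable_iid_tuple.
- exact: measurable_iid_tuple.
- by apply/measurable_EFinP; exact: (measurableT_comp mk (@measurable_scaled n)).
- move=> A mA; apply: (iid_tuple_law W_iid (u := fun i => nat_of_ord (idx j i))
    (v := fun i => nat_of_ord (idx j0 i))) => //; exact: idx_inj.
Qed.

(** Carries the assumed limit law from the first [n] observations to the first subsample, both being
    tuples at distinct positions. *)
Lemma full_estimator_law n x :
  Pr [set w | X1 n w <= x] =
  Pr [set w | r n * (full_estimator W theta_hat n w - theta0) <= x].
Proof.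
have mA : measurable [set t : n.-tuple S | scaled t <= x].
  have := @measurable_scaled n measurableT _ (measurable_itv `]-oo, x]).
  by rewrite setTI; congr measurable; apply/seteqP; split=> w; rewrite /= in_itv.
exact: (iid_tuple_law W_iid (u := fun i => nat_of_ord (idx (Ordinal (m_gt0 n)) i))
  (v := @nat_of_ord n) (@idx_inj _ _) (@ord_inj n) mA).
Qed.

Lemma xi_independent n (j : 'I_(m n)) :
  independent_pair Pr (X j) (fun w => \sum_(i < m n) X i w - X j w).
Proof.
pose I1 : set nat := [set k | exists i, nat_of_ord (idx j i) = k].
(* The difference is rewritten as a sum without index [j], so that every term is visibly measurable
   for the sigma-algebra of the positions outside the block of [j]. *)
have -> : (fun w => \sum_(i < m n) X i w - X j w) =
    (fun w => \sum_(i < m n) (if i != j then X i w else 0)).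
  by apply/funext => w; rewrite -big_mkcond (bigD1 j)//= addrAC subrr add0r.
apply: (cylinders_independent_pair W_iid (I1 := I1) (I2 := ~` I1)).
- by move=> k; rewrite /= /not.
- apply: (measurableT_comp (@measurable_scaled n)).
  by apply: (measurable_cylinders_tuple (u := fun i => nat_of_ord (idx j i))) => i; exists i.
- apply: measurable_sum => i; case: (boolP (i != j)) => [ij|_]; last exact: measurable_cst.
  apply: (measurableT_comp (@measurable_scaled n)).
  apply: (measurable_cylinders_tuple (u := fun k => nat_of_ord (idx i k))) => k [l].
  move=> /ord_inj E; have := @idx_disjoint n (j, l) (i, k) E.
  by move=> [ji _]; rewrite ji eqxx in ij.
Qed.

Lemma averaged_estimator_normalized n w :
  Num.sqrt (m n)%:R * r n * (averaged_estimator W theta_hat idx n w - theta0) =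
  (Num.sqrt (m n)%:R)^-1 * \sum_(j < m n) X j w.
Proof.
have m0 : 0 < (m n)%:R :> R by rewrite ltr0n.
have sq0 : Num.sqrt (m n)%:R != 0 :> R by rewrite lt0r_neq0// sqrtr_gt0.
have mE : (m n)%:R = Num.sqrt (m n)%:R ^+ 2 :> R by rewrite sqr_sqrtr// ltW.
rewrite /X /xi -mulr_sumr sumrB sumr_const card_ord -[theta0 *+ _]mulr_natl.
rewrite /averaged_estimator; set s := \sum_(j < m n) _.
by rewrite mE sqrtr_sqr ger0_norm ?sqrtr_ge0//; field.
Qed.

Lemma averaged_estimator_cvg {dQ : measure_display} {TQ : measurableType dQ}
    (Q : probability TQ R) (G : {RV Q >-> R}) (sigma tau : R) (b : nat -> R) :
  0 < sigma -> ('E_Q[G] = 0)%E -> ('V_Q[G] = (sigma ^+ 2)%:E)%E ->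
  cvg_in_distribution Pr
    (fun n w => r n * (full_estimator W theta_hat n w - theta0)) (distribution Q G) ->
  (forall n : nat, (0 < n)%N -> ('E_Pr[X1 n] = (b n)%:E)%E) ->
  uniformly_integrable Pr [set n : nat | (0 < n)%N] (fun n w => X1 n w ^+ 2) ->
  ((m n)%:R : R) @[n --> \oo] --> +oo ->
  Num.sqrt (m n)%:R * b n @[n --> \oo] --> tau ->
  cvg_in_distribution Pr
    (fun n w => Num.sqrt (m n)%:R * r n *
       (averaged_estimator W theta_hat idx n w - theta0))
    (normal_prob tau sigma).
Proof.
move=> s0 G0 Gv XG bE ui m_oo tauc.
have [iG2 EG2] := mean0_variance G0 Gv.
have mX1 n : (0 < n)%N -> measurable_fun setT (X1 n) by move=> _; exact: measurable_xi.
have tails := uniformly_integrable_sqr_tail mX1 ui.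
have X1G : cvg_in_distribution Pr X1 (distribution Q G).
  by move=> x cx; under eq_fun do rewrite full_estimator_law; exact: XG.
have v_cvg := second_moment_cvg_in_distribution mX1 ui iG2 X1G.
rewrite EG2 in v_cvg.
have iX1 n : (0 < n)%N -> Pr.-integrable setT (EFin \o (fun w => X1 n w ^+ 2)).
  by have [K KH] := tails 1 ltr01; move=> n0; have [] := KH n K n0 (lexx K).
have -> : (fun n w => Num.sqrt (m n)%:R * r n *
    (averaged_estimator W theta_hat idx n w - theta0)) = normalized_sum X.
  by apply/funext => n; apply/funext => w; exact: averaged_estimator_normalized.
have m2 : measurable_fun setT (fun x : R => x ^+ 2) by exact: measurable_funX.
apply: (@normalized_sum_cvg _ _ _ Pr m X b
  (fun n => \int[Pr]_w (X1 n w ^+ 2))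
  (fun n k => \int[Pr]_w (X1 n w ^+ 2 * \1_[set x : R | k < `|x|] (X1 n w)))) => //.
- by move=> n j _; exact: measurable_xi.
- move=> n j n0; have /integrableP[_ fin1] := iX1 n n0; apply/integrableP; split.
    by apply/measurable_EFinP; apply: measurable_funX; exact: measurable_xi.
  rewrite (xi_law j (k := fun x => `|x ^+ 2|))//.
  exact: (measurableT_comp (@normr_measurable R setT) m2).
- by move=> n j _; exact: xi_independent.
- move=> n j n0; have := bE n n0; rewrite expectation.unlock => E.
  by rewrite /Rintegral (xi_law j (k := id))// E.
- by move=> n j n0; rewrite /Rintegral (xi_law j (k := fun x => x ^+ 2)).
- move=> n j k n0.
  rewrite /Rintegral (xi_law j (k := fun x => x ^+ 2 * \1_[set x : R | k < `|x|] x))//.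
  by apply: measurable_funM => //; exact: measurable_indic_normr_gt.
- move=> n k; apply: Rintegral_ge0 => w _; apply: mulr_ge0; first exact: sqr_ge0.
  by rewrite indicE ler0n.
- by move=> e /tails[K KH]; exists K => n k n0 Kk; have [] := KH n k n0 Kk.
Qed.

End divided_sample_theory.

Theorem theorem3p1 (R : realType)
  (d dS dQ : measure_display) (T : measurableType d) (S : measurableType dS)
  (TQ : measurableType dQ) (Pr : probability T R) (Q : probability TQ R)
  (W : nat -> {mfun T >-> S}) (P : probability S R) (W_iid : iid Pr W P)
  (theta : probability S R -> R)
  (theta_hat : forall n : nat, {mfun n.-tuple S >-> R})
  (r : nat -> R) (r_gt0 : forall n : nat, (0 < n)%N -> 0 < r n)
  (r_o : r =o_\oo (fun n : nat => Num.sqrt n%:R : R))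
  (G : {RV Q >-> R}) (sigma : R) (sigma_gt0 : 0 < sigma)
  (G_mean : ('E_Q[G] = 0)%E) (G_var : ('V_Q[G] = (sigma ^+ 2)%:E)%E)
  (G_not_normal : forall mu s : R, s != 0 ->
     ~ (forall A : set R, measurable A ->
          distribution Q G A = normal_prob mu s A))
  (cvg_G : cvg_in_distribution Pr
     (fun n w => r n * (full_estimator W theta_hat n w - theta P))
     (distribution Q G))
  (m : nat -> nat) (m_gt0 : forall n : nat, (0 < m n)%N)
  (idx : forall n : nat, 'I_(m n) -> 'I_n -> 'I_(m n * n))
  (idx_disjoint : disjoint_subsamples idx)
  (xi1_integrable : forall n : nat, (0 < n)%N ->
     Pr.-integrable setT (EFin \o xi1 W theta_hat (theta P) r idx m_gt0 n))
  (b c : nat -> R)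
  (bE : forall n : nat, (0 < n)%N ->
     ('E_Pr[xi1 W theta_hat (theta P) r idx m_gt0 n] = (b n)%:E)%E)
  (c_oo : c n @[n --> \oo] --> +oo)
  (b_O : b =O_\oo (fun n : nat => (c n)^-1))
  (xi1_ui : uniformly_integrable Pr [set n : nat | (0 < n)%N]
     (fun n w => xi1 W theta_hat (theta P) r idx m_gt0 n w ^+ 2)) :
  (((m n)%:R : R) @[n --> \oo] --> +oo ->
   (fun n : nat => (m n)%:R : R) =o_\oo (fun n : nat => c n ^+ 2) ->
   cvg_in_distribution Pr
     (fun n w => Num.sqrt (m n)%:R * r n *
        (averaged_estimator W theta_hat idx n w - theta P))
     (normal_prob 0 sigma))
  /\
  (forall tau : R,
   ((m n)%:R : R) @[n --> \oo] --> +oo ->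
   (fun n : nat => (m n)%:R : R) =O_\oo (fun n : nat => c n ^+ 2) ->
   Num.sqrt (m n)%:R * b n @[n --> \oo] --> tau ->
   cvg_in_distribution Pr
     (fun n w => Num.sqrt (m n)%:R * r n *
        (averaged_estimator W theta_hat idx n w - theta P))
     (normal_prob tau sigma)).
Proof.
have main tau := averaged_estimator_cvg W_iid (theta0 := theta P) idx_disjoint
  (tau := tau) sigma_gt0 G_mean G_var cvg_G bE xi1_ui.
split => [m_oo m_o|tau m_oo _]; last exact: main.
by apply: main => //; exact: sqrt_mul_cvg0 m_o.
Qed.
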